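(* Let $K$ be an algebraically closed field. For all integers $n, d \ge 2$ the set \[ \mathcal{E}_{n,d} := \{f \in \mathrm{End}^n_{d/K} : \text{the critical scheme } C_f \text{ is an integral hypersurface in } \mathbb{P}^n_K\} \] is a non-empty and Zariski-open subset of $\mathrm{End}^n_{d/K}$.
   Context: Parameter space: a form is a homogeneous polynomial. Let $K[\mathbf{x}]_d$ be the $K$-vector space of forms of degree $d$ in $K[\mathbf x]=K[x_0,\ldots,x_n]$ (including $0$), and let $\overline{\mathrm{End}}^n_d := \mathbb{P}(K[\mathbf{x}]_d^{n+1})$ be the projective space whose $K$-points are classes $[F]=[F_0:\ldots:F_n]$ of nonzero tuples of forms of degree $d$ up to simultaneous nonzero scaling. $\mathrm{End}^n_{d/K}\subseteq \overline{\mathrm{End}}^n_d$ is the Zariski-open subset of those $[F]$ such that $F_0,\ldots,F_n$ have no common zero in $\mathbb{P}^n(K)$; such an $[F]$ is identified with the degree-$d$ endomorphism $f:\mathbb{P}^n\to\mathbb{P}^n$, $x\mapsto [F_0(x):\ldots:F_n(x)]$. Critical scheme: let $f: X \to Y$ be a morphism of nonsingular varieties over $K$ of the same dimension $r$. It induces a homomorphism of vector bundles $f^*(T^*Y)\to T^*X$ and, dually, the differential $f': TX \to f^*(TY)$, a homomorphism of rank-$r$ vector bundles on $X$. The critical scheme $C_f$ is the zero scheme of $\det f'$: the closed subscheme of $X$ which on each open set trivializing both bundles is defined by the determinant of a matrix representing $f'$. A hypersurface is a closed subscheme of pure codimension $1$; it is integral iff it is irreducible and reduced (the empty scheme is not integral).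 *)

(* Defs.v *)
From mathcomp Require Export all_boot all_order all_algebra.
From mathcomp Require Export boolp classical_sets.
From mathcomp Require Export mpoly.

Set Implicit Arguments.
Unset Strict Implicit.
Unset Printing Implicit Defensive.

Import GRing.Theory.
Local Open Scope ring_scope.
Local Open Scope classical_set_scope.

(* The two Zariski topologies below (on K-points of a projective space, and on
   Proj) are each given by their family [closed : set (set X)] of closed sets. *)

Definition open_in (X : Type) (closed : set (set X)) (A B : set X) : Prop :=
  exists2 C, closed C & B = A `\` C.

Definition irreducible_set (X : Type) (closed : set (set X)) (Z : set X) :=
  Z !=set0 /\
  forall A B, closed A -> closed B -> Z `<=` A `|` B -> Z `<=` A \/ Z `<=` B.

Definition irreducible_component (X : Type) (closed : set (set X))
    (Z Y : set X) : Prop :=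
  [/\ irreducible_set closed Y, Y `<=` Z &
      forall Y', irreducible_set closed Y' -> Y `<=` Y' -> Y' `<=` Z ->
        Y' `<=` Y].

Definition ascending_chain (X : Type) (closed : set (set X)) (Y : set X)
    (m : nat) (W : nat -> set X) : Prop :=
  [/\ W 0%N = Y,
      forall k, (k <= m)%N -> closed (W k) /\ irreducible_set closed (W k) &
      forall k, (k < m)%N -> W k `<` W k.+1].

Definition has_codim (X : Type) (closed : set (set X)) (Y : set X) (c : nat) :=
  (exists W, ascending_chain closed Y c W) /\
  (forall m W, ascending_chain closed Y m W -> (m <= c)%N).

Definition pure_codim (X : Type) (closed : set (set X)) (Z : set X) (c : nat) :=
  forall Y, irreducible_component closed Z Y -> has_codim closed Y c.

(* K-points of P(V): a class of nonzero vectors up to scaling is identified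
   with the line it spans. *)
Definition projective (K : fieldType) (V : vectType K) : Type :=
  {L : {vspace V} | \dim L == 1%N}.

(* A nonzero representative of the class; everything defined from it below is
   invariant under scaling. *)
Definition repr_vec (K : fieldType) (V : vectType K) (x : projective V) : V :=
  vpick (val x).

Definition proj_closed (K : fieldType) (V : vectType K) :
    set (set (projective V)) :=
  [set C | exists2 T : set {mpoly K[\dim {:V}]},
     (forall P, T P -> exists e, P \is e.-homog) &
     C = [set x | forall P, T P ->
            P.@[fun i => coord (vbasis {:V}) i (repr_vec x)] = 0]].

Definition form_tuple (K : fieldType) (n d : nat) : vectType K :=
  {ffun 'I_n.+1 -> dhomog n.+1 K d}.

Definition EndBar (K : fieldType) (n d : nat) : Type :=
  projective (form_tuple K n d).

Definition forms (K : fieldType) (n d : nat) (f : EndBar K n d)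
    (j : 'I_n.+1) : {mpoly K[n.+1]} :=
  (repr_vec f : {ffun 'I_n.+1 -> dhomog n.+1 K d}) j.

Definition EndSet (K : fieldType) (n d : nat) : set (EndBar K n d) :=
  [set f | ~ exists2 z : 'I_n.+1 -> K,
             (exists i, z i != 0) & forall j, (forms f j).@[z] = 0].

(* Points of the scheme P^n_K = Proj K[x_0, ..., x_n]. *)
Record Proj (K : fieldType) (n : nat) : Type := ProjPoint {
  pt_ideal :> {pred {mpoly K[n.+1]}};
  pt_idealr : idealr_closed pt_ideal;
  pt_prime : prime_idealr_closed pt_ideal;
  pt_homog : forall e G, G \in pt_ideal -> pihomog mdeg e G \in pt_ideal;
  pt_relevant : exists i, 'X_i \notin pt_ideal
}.

Definition Proj_closed (K : fieldType) (n : nat) : set (set (Proj K n)) :=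
  [set C | exists2 T : set {mpoly K[n.+1]},
     (forall G, T G -> exists e, G \is e.-homog) &
     C = [set p : Proj K n | forall G, T G -> G \in p]].

(* The local ring of P^n at p, inside the field K(x_0, ..., x_n). *)
Definition local_ring (K : fieldType) (n : nat) (p : Proj K n) :
    set {fraction {mpoly K[n.+1]}} :=
  [set g | exists e (a b : {mpoly K[n.+1]}),
     [/\ a \is e.-homog, b \is e.-homog, b \notin p &
         g = tofrac a / tofrac b]].

(* A closed subscheme of P^n is determined by the stalks of its ideal sheaf,
   p |-> I_p, an ideal of [local_ring p]. *)
Definition ideal_stalks (K : fieldType) (n : nat) : Type :=
  Proj K n -> set {fraction {mpoly K[n.+1]}}.

Definition subscheme_support (K : fieldType) (n : nat) (I : ideal_stalks K n) :
    set (Proj K n) :=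
  [set p | I p <> local_ring p].

Definition reduced_subscheme (K : fieldType) (n : nat) (I : ideal_stalks K n) : Prop :=
  forall p g k, local_ring p g -> I p (g ^+ k) -> I p g.

Definition hypersurface (K : fieldType) (n : nat) (I : ideal_stalks K n) :=
  pure_codim (@Proj_closed K n) (subscheme_support I) 1.

Definition integral_subscheme (K : fieldType) (n : nat) (I : ideal_stalks K n) :=
  irreducible_set (@Proj_closed K n) (subscheme_support I) /\
  reduced_subscheme I.

(* On D_+(x_i), with affine coordinates u_k = x_k / x_i (k != i), and for forms
   a, b of the same degree, d(a/b)/du_k = x_i * d(a/b)/dx_k. *)
Definition chart_deriv (K : fieldType) (n : nat) (i k : 'I_n.+1)
    (a b : {mpoly K[n.+1]}) : {fraction {mpoly K[n.+1]}} :=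
  tofrac 'X_i *
  (tofrac (a^`M(k) * b - a * b^`M(k)) / tofrac (b ^+ 2)).

(* Matrix of the differential of f on D_+(x_i F_j), with respect to the
   coordinates x_k / x_i (k != i) on the source and y_l / y_j (l != j) on the
   target; both tangent bundles are trivial there. *)
Definition diff_mx (K : fieldType) (n d : nat) (f : EndBar K n d)
    (i j : 'I_n.+1) : 'M[{fraction {mpoly K[n.+1]}}]_n :=
  \matrix_(l < n, k < n)
    chart_deriv i (lift i k) (forms f (lift j l)) (forms f j).

(* Zero scheme of det f'. The opens D_+(x_i F_j) cover P^n when f is in
   [EndSet]; the determinants of two charts containing p differ by a unit of
   [local_ring p], so the choice of (i, j) is immaterial. *)
Definition critical_scheme (K : fieldType) (n d : nat) (f : EndBar K n d) :
    ideal_stalks K n :=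
  fun p => [set g | exists i j,
    [/\ 'X_i \notin p, forms f j \notin p &
        exists2 a, local_ring p a & g = a * \det (diff_mx f i j)]].

Definition integral_critical_locus (K : fieldType) (n d : nat) :
    set (EndBar K n d) :=
  [set f | [/\ EndSet f, hypersurface (critical_scheme f) &
               integral_subscheme (critical_scheme f)]].

(* Main.v *)
(* By Euler's relation the Jacobian determinant with column i replaced by the forms
   F_0, ..., F_n equals x_i c for a form c of degree D = (n+1)(d-1) independent of i,
   in every characteristic, and the critical scheme of F is the zero scheme of c. Since
   polynomial rings are factorial, it is an integral hypersurface iff c is irreducible.

   For 0 < k < D, the condition "x_0 c = x_0 g h with g <> 0 of degree k" is closed in
   the coefficients of F by elimination theory, applied to the rank one tensor g (x) h.
   Elimination rests on the projective Nullstellensatz: if I is a graded ideal of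
   A = K[x_0, ..., x_n] with A/I of infinite dimension, then for linear forms l1, l2 some
   nontrivial combination l of them keeps A/(I + (l)) of infinite dimension, and adding
   such combinations one at a time cuts out a zero of I.

   Nonempty open subsets of the parameter space meet, so one tuple F with c irreducible
   suffices, even if F is not an endomorphism. In the affine coordinates x_0 = 1, x = x_1,
   z = x_2 of the plane x_3 = ... = x_n = 0 the one used here has
   c = r' s z - (r + k)(r s + x r') with s = 1 + x^N r, linear in z with coprime
   coefficients for suitable r in K[x] and k in K, whatever the characteristic. *)

From HB Require Import structures.
From mathcomp Require Import perm ssrAC.
Require Import Defs.

Set Implicit Arguments.
Unset Strict Implicit.
Unset Printing Implicit Defensive.

Import GRing.Theory.
Local Open Scope ring_scope.
Local Open Scope classical_set_scope.

(** * Factorial domains *)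

(** When the characteristic divides d, Euler's relation makes the columns of the matrix of all
    partial derivatives dependent, so its determinant vanishes; this is why a column of values
    replaces a column of derivatives. The quotient c is not visibly polynomial in the coefficients
    of F, whereas x_0 c is a determinant, so closedness is tested on x_0 c. The factor h may be 0,
    which puts c = 0 into the closed bad set; this is right, because the critical scheme is then all
    of P^n. In the example, irreducibility on the plane is not enough: a factor of c of positive
    degree could restrict to a nonzero constant there. The construction therefore gives the part of
    c free of z the full degree D in x. If one factor restricts to a constant, its cofactor has
    degree less than D and cannot carry that part. The power x^N in s, with N = (n-2)(d-1), supplies
    the missing degree: deg r = d-1 and N + 3(d-1) = D. *)

Section Factorial.
Variable R : idomainType.

Definition divides (a b : R) : Prop := exists q, b = a * q.

Definition irreducible_elt (a : R) : Prop :=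
  [/\ a != 0, a \isn't a GRing.unit &
      forall b c, a = b * c -> b \is a GRing.unit \/ c \is a GRing.unit].

(** Unique factorization, encoded by a measure: the first two clauses let an induction on [dg]
    terminate at irreducible factors, the third makes irreducibles prime. The measure is explicit so
    that it can be extended to polynomials and carried along isomorphisms. *)
Definition factorial_by (dg : R -> nat) : Prop :=
  [/\ forall a b, a != 0 -> b != 0 -> dg (a * b) = (dg a + dg b)%N,
      forall a, a != 0 -> dg a = 0%N -> a \is a GRing.unit &
      forall p a b, irreducible_elt p -> divides p (a * b) ->
        divides p a \/ divides p b].

Lemma divides_mulr p a b : divides p a -> divides p (a * b).
Proof. by case=> q ->; exists (q * b); rewrite mulrA. Qed.

Lemma divides_refl p : divides p p.
Proof. by exists 1; rewrite mulr1. Qed.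

Lemma divides_trans p q r : divides p q -> divides q r -> divides p r.
Proof. by case=> a -> [b ->]; exists (a * b); rewrite mulrA. Qed.

Lemma irreducible_factor dg a : factorial_by dg -> a != 0 ->
  a \isn't a GRing.unit -> exists2 p, irreducible_elt p & divides p a.
Proof.
move=> [dgM dgU _]; have [m] := ubnP (dg a).
elim: m a => // m IHm a /ltnSE le_am a0 aU.
have [irr|nirr] := pselect (irreducible_elt a).
  by exists a => //; apply: divides_refl.
have [b [c [aE [bU cU]]]] : exists b c, a = b * c /\
    (b \isn't a GRing.unit /\ c \isn't a GRing.unit).
  apply: contrapT => nex; apply: nirr; split=> // b c aE.
  have [bU|bU] := boolP (b \is a GRing.unit); first by left.
  have [cU|cU] := boolP (c \is a GRing.unit); first by right.
  by case: nex; exists b, c.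
have b0 : b != 0 by apply: contraNneq a0 => b0; rewrite aE b0 mul0r.
have c0 : c != 0 by apply: contraNneq a0 => c0; rewrite aE c0 mulr0.
have dgc : (0 < dg c)%N.
  by rewrite lt0n; apply: contraNneq cU => /(dgU _ c0).
have [|p irrp pb] := IHm b _ b0 bU.
  by apply: leq_trans le_am; rewrite aE dgM // -{1}[dg b]addn0 ltn_add2l.
by exists p => //; rewrite aE; apply: divides_mulr.
Qed.

End Factorial.

(** * Gauss's lemma: polynomials over a factorial domain *)

Section PolyFactorial.
Variables (R : idomainType) (dg : R -> nat).
Hypothesis factR : factorial_by dg.
Implicit Types (p q f g h : {poly R}).

(** A leading term divisible by [a] can be removed from [p] or [q] without affecting either side, so
    induction on the sizes applies. When neither leading coefficient is divisible by [a], neither is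
    their product, the leading coefficient of [p * q]. *)
Lemma polyC_irreducible_prime (a : R) p q : irreducible_elt a ->
  divides a%:P (p * q) -> divides a%:P p \/ divides a%:P q.
Proof.
move=> irra; have [_ _ primeR] := factR.
have [m] := ubnP (size p + size q); elim: m p q => // m IHm p q /ltnSE le_m apq.
have [->|p0] := eqVneq p 0; first by left; exists 0; rewrite mulr0.
have [->|q0] := eqVneq q 0; first by right; exists 0; rewrite mulr0.
have dlead (f : {poly R}) : divides a (lead_coef f) -> f != 0 ->
    exists f', [/\ (size f' < size f)%N, divides a%:P (f - f') &
                  f' = f - lead_coef f *: 'X^((size f).-1)].
  move=> [b lfE] f0; exists (f - lead_coef f *: 'X^((size f).-1)); split=> //.
    have sf : (0 < size f)%N by rewrite size_poly_gt0.
    rewrite -[X in (_ < X)%N](prednK sf) ltnS; apply/leq_sizeP => j le_j.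
    rewrite coefB coefZ coefXn; move: le_j; rewrite leq_eqVlt => /orP[/eqP<-|lt_j].
      by rewrite eqxx mulr1 lead_coefE subrr.
    rewrite (gtn_eqF lt_j) mulr0 subr0 nth_default //.
    by rewrite -(prednK sf).
  exists (b *: 'X^((size f).-1)).
  by rewrite opprB addrC subrK lfE mul_polyC scalerA.
have [al|nal] := pselect (divides a (lead_coef p)).
  have [p' [ltp dp _]] := dlead p al p0.
  have [||ap'|] := IHm p' q; last by right.
  - by apply: leq_trans le_m; rewrite ltn_add2r.
  - case: dp apq => u uE [v vE]; exists (v - u * q).
    by rewrite mulrBr -vE mulrA -uE mulrBl opprB addrC subrK.
  case: dp ap' => u uE [v vE]; left; exists (u + v).
  by rewrite mulrDr -uE -vE subrK.
have [ar|nar] := pselect (divides a (lead_coef q)).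
  have [q' [ltp dp _]] := dlead q ar q0.
  have [|||aq'] := IHm p q'; first 1 last.
  - case: dp apq => u uE [v vE]; exists (v - p * u).
    by rewrite mulrBr -vE mulrCA -uE mulrBr opprB addrC subrK.
  - by left.
  - case: dp aq' => u uE [v vE]; right; exists (u + v).
    by rewrite mulrDr -uE -vE subrK.
  - by apply: leq_trans le_m; rewrite ltn_add2l.
case: apq => u uE; have: divides a (lead_coef (p * q)).
  by exists (lead_coef u); rewrite uE lead_coefM lead_coefC.
by rewrite lead_coefM => /(primeR _ _ _ irra)[].
Qed.

(** Each irreducible factor of [c] divides [f * q] but not [f], hence divides [q] and can be
    cancelled. This upgrades pseudo-divisibility, which holds only up to a scalar, to true
    divisibility. *)
Lemma divides_scale_primitive f g q (c : R) :
    (forall a, irreducible_elt a -> ~ divides a%:P f) ->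
  c != 0 -> c *: g = f * q -> divides f g.
Proof.
move=> primf; have [dgM dgU _] := factR.
have [m] := ubnP (dg c); elim: m c q => // m IHm c q /ltnSE le_m c0 E.
have [cU|cU] := boolP (c \is a GRing.unit).
  exists (c^-1 *: q); rewrite -scalerAr -E scalerA mulVr ?scale1r //.
have [p irrp [b cE]] := irreducible_factor factR c0 cU.
have [p0 pU _] := irrp.
have b0 : b != 0 by apply: contraNneq c0 => b0; rewrite cE b0 mulr0.
have [|/(primf _ irrp)//|[q' q'E]] := @polyC_irreducible_prime p f q irrp.
  by exists (b *: g); rewrite -E cE mul_polyC scalerA.
apply: (IHm b q') => //.
  apply: leq_trans le_m; rewrite cE dgM // -{1}[dg b]add0n ltn_add2r lt0n.
  by apply: contraNneq pU => /(dgU _ p0).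
have pP0 : p%:P != 0 by rewrite polyC_eq0.
by apply: (mulfI pP0); rewrite mul_polyC scalerA -cE E q'E mulrCA.
Qed.

(** The irreducible factors of [c] are cancelled one by one from [g] or [h]. Keeping the sizes lets
    degree arguments over the fraction field descend to [R]. *)
Lemma gauss_factorization f g h (c : R) : c != 0 -> c *: f = g * h ->
  exists g' h', [/\ f = g' * h', size g' = size g & size h' = size h].
Proof.
have [dgM dgU _] := factR.
have [m] := ubnP (dg c); elim: m c g h => // m IHm c g h /ltnSE le_m c0 E.
have [cU|cU] := boolP (c \is a GRing.unit).
  exists (c^-1 *: g), h; split=> //; last first.
    by rewrite size_scale // invr_eq0.
  by rewrite -scalerAl -E scalerA mulVr ?scale1r.
have [p irrp [b cE]] := irreducible_factor factR c0 cU.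
have [p0 pU _] := irrp.
have b0 : b != 0 by apply: contraNneq c0 => b0; rewrite cE b0 mulr0.
have pP0 : p%:P != 0 by rewrite polyC_eq0.
have lt_m : (dg b < m)%N.
  apply: leq_trans le_m; rewrite cE dgM // -{1}[dg b]add0n ltn_add2r lt0n.
  by apply: contraNneq pU => /(dgU _ p0).
have [|[g' gE]|[h' hE]] := @polyC_irreducible_prime p g h irrp.
- by exists (b *: f); rewrite -E cE mul_polyC scalerA.
- have [|g1 [h1 [fE s1 s2]]] := IHm b g' h lt_m b0.
    by apply: (mulfI pP0); rewrite mul_polyC scalerA -cE E gE mulrA.
  by exists g1, h1; split=> //; rewrite s1 gE mul_polyC size_scale.
- have [|g1 [h1 [fE s1 s2]]] := IHm b g h' lt_m b0.
    by apply: (mulfI pP0); rewrite mul_polyC scalerA -cE E hE mulrCA.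
  by exists g1, h1; split=> //; rewrite s2 hE mul_polyC size_scale.
Qed.

Lemma polyC_irreducible (a : R) : irreducible_elt a%:P -> irreducible_elt a.
Proof.
move=> [a0 aU irr]; split; first by rewrite -polyC_eq0.
  by apply: contra aU => aU; rewrite poly_unitE coefC eqxx aU size_polyC -polyC_eq0 a0.
move=> b c aE; have := irr b%:P c%:P; rewrite aE polyCM => /(_ erefl).
by rewrite !poly_unitE !coefC !eqxx => -[]/andP[]; [left|right].
Qed.

Definition poly_deg f := ((size f).-1 + dg (lead_coef f))%N.

Import Pdiv.Idomain.

(** An irreducible of positive degree is primitive and stays irreducible over the fraction field,
    where the gcd with [g] is either trivial or associated to [f]; both cases are brought back to
    [R] by the primitivity of [f]. *)
Lemma poly_factorial : factorial_by poly_deg.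
Proof.
have [dgM dgU primeR] := factR.
split=> [p q p0 q0|p p0|f g h irrf fgh].
- rewrite /poly_deg lead_coefM dgM ?lead_coef_eq0 // size_mul //.
  have := p0; have := q0; rewrite -!size_poly_gt0.
  by case: (size p) (size q) => // sp [|sq] //= _ _; rewrite addnS /= addnACA.
- move=> /eqP; rewrite addn_eq0 => /andP[/eqP s0 /eqP d0].
  have sp1 : size p = 1%N.
    by move: p0 s0; rewrite -size_poly_gt0; case: (size p) => // k _ /= ->.
  rewrite poly_unitE sp1 eqxx /= (_ : p`_0 = lead_coef p) ?dgU ?lead_coef_eq0 //.
  by rewrite lead_coefE sp1.
have [f0 fU irr] := irrf.
have [/eqP sf1|sf1] := boolP (size f == 1).
  have /size_poly1P[a a0 fE] := introT eqP sf1.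
  by rewrite fE in irrf fgh *; apply: polyC_irreducible_prime => //; apply: polyC_irreducible.
have sf_gt1 : (1 < size f)%N.
  by move: f0 sf1; rewrite -size_poly_gt0; case: (size f) => [|[]].
have primf a : irreducible_elt a -> ~ divides a%:P f.
  move=> [a0 aU _] [t fE].
  have [|] := irr _ _ fE; rewrite poly_unitE.
    by rewrite coefC eqxx (negPf aU) andbF.
  case/andP=> /eqP st _; move: sf1; rewrite fE mul_polyC size_scale // st.
  by rewrite eqxx.
(* The relation [%|] is pseudo-divisibility, so this is irreducibility over the fraction field. *)
have irrf' : irreducible_poly f.
  split=> // q sq1; rewrite dvdp_eq => /eqP E.
  have lq0 : lead_coef q ^+ scalp f q != 0.
    rewrite expf_neq0 // lead_coef_eq0; apply: contraNneq f0 => q0.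
    by move/eqP: E; rewrite q0 mulr0 lead_coef0 scalp0 expr0 scale1r.
  have [g' [h' [fE s1 s2]]] := gauss_factorization lq0 E.
  have [|] := irr _ _ fE; rewrite poly_unitE => /andP[/eqP su _]; last first.
    by move: sq1; rewrite -s2 su.
  rewrite -dvdp_size_eqp; last by rewrite dvdp_eq -E.
  have h'0 : h' != 0 by apply: contraNneq f0 => h'0; rewrite fE h'0 mulr0.
  have g'0 : g' != 0 by apply: contraNneq f0 => g'0; rewrite fE g'0 mul0r.
  by rewrite fE size_mul // su s2.
have dvdD q : f %| q -> divides f q.
  rewrite dvdp_eq => /eqP; rewrite mulrC; apply: divides_scale_primitive => //.
  by rewrite expf_neq0 // lead_coef_eq0.
have fgh' : f %| g * h.
  by case: fgh => q ->; apply: dvdp_mulIl.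
have [cfg|ncfg] := boolP (coprimep f g).
  by right; apply: dvdD; rewrite -(Gauss_dvdpr _ cfg).
left; apply: dvdD; have [_ /(_ (gcdp f g))] := irrf'.
rewrite -coprimep_def => /(_ ncfg (dvdp_gcdl _ _)) /eqp_dvdl <-.
exact: dvdp_gcdr.
Qed.

End PolyFactorial.

Lemma factorial_iso (R S : idomainType) (phi : {rmorphism R -> S})
    (psi : S -> R) (dg : R -> nat) :
  cancel phi psi -> cancel psi phi -> factorial_by dg ->
  factorial_by (dg \o psi).
Proof.
move=> phiK psiK [dgM dgU primeR].
have psiM a b : psi (a * b) = psi a * psi b.
  by rewrite -[a]psiK -[b]psiK -rmorphM !phiK.
have psi0 : psi 0 = 0 by rewrite -(rmorph0 phi) phiK.
have psi_eq0 a : (psi a == 0) = (a == 0).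
  by rewrite -psi0 (can_eq psiK).
have psiU a : (psi a \is a GRing.unit) = (a \is a GRing.unit).
  apply/idP/idP => [u|/unitrP[b [ba ab]]].
    by rewrite -[a]psiK rmorph_unit.
  have psi1 : psi 1 = 1 by rewrite -(rmorph1 phi) phiK.
  by apply/unitrP; exists (psi b); rewrite -!psiM ba ab psi1.
have divP a b : divides (psi a) (psi b) -> divides a b.
  by case=> q E; exists (phi q); apply: (can_inj psiK); rewrite psiM phiK.
split=> [a b a0 b0|a a0 /= /dgU|p a b [p0 pU irr] [q E]].
- by rewrite /= psiM dgM ?psi_eq0.
- by rewrite psiU psi_eq0; apply.
have irrp : irreducible_elt (psi p).
  split; rewrite ?psi_eq0 ?psiU // => b' c' /(congr1 phi).
  rewrite psiK rmorphM => /irr[]; rewrite -psiU phiK; by [left|right].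
have [|/divP|/divP] := primeR (psi p) (psi a) (psi b) irrp; [|by left|by right].
by exists (psi q); rewrite -!psiM E.
Qed.

Section MpolyFactorial.
Variable K : fieldType.

Lemma muniXmax n : muni 'X_(@ord_max n) = 'X :> {poly {mpoly K[n]}}.
Proof.
rewrite muniE msuppX big_seq1 mcoeffX eqxx scale1r mnm1E eqxx expr1.
rewrite [X in 'X_[X] *: _](_ : _ = 0%MM) ?mpolyX0 ?scale1r //.
apply/mnmP => i; rewrite mnmE mnm1E mnm0E -val_eqE /=.
by rewrite gtn_eqF.
Qed.

Lemma muniXwiden n (i : 'I_n) :
  muni 'X_(widen_ord (leqnSn n) i) = ('X_i)%:P :> {poly {mpoly K[n]}}.
Proof.
rewrite muniE msuppX big_seq1 mcoeffX eqxx scale1r mnm1E.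
rewrite -val_eqE /= ltn_eqF // expr0 alg_polyC; congr (_%:P); congr ('X_[_]).
by apply/mnmP => j; rewrite mnmE !mnm1E -!val_eqE.
Qed.

Lemma mpoly_rmorph_eq n (S : comNzRingType) (f g : {rmorphism {mpoly K[n]} -> S}) :
  (forall c, f c%:MP = g c%:MP) -> (forall i, f 'X_i = g 'X_i) -> f =1 g.
Proof.
move=> fgC fgX p; rewrite [p]mpolyE !rmorph_sum; apply: eq_bigr => m _.
rewrite -mul_mpolyC !rmorphM fgC; congr (_ * _).
rewrite mpolyXE_id !rmorph_prod; apply: eq_bigr => i _.
by rewrite !rmorphXn fgX.
Qed.

(** Induction on the number of variables: the last one is split off by [muni], whose inverse [phi]
    evaluates at that variable. Both composites are checked on generators. *)
Lemma mpoly_factorial n : exists dg : {mpoly K[n]} -> nat, factorial_by dg.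
Proof.
elim: n => [|n [dg fdg]].
  have unit0 (p : {mpoly K[0]}) : p != 0 -> p \is a GRing.unit.
    move=> p0; have pE := @mpolyKC K; have : p = (p@_0)%:MP.
      by apply/mpolyP => m; rewrite mcoeffC (_ : m = 0%MM) ?eqxx ?mulr1 //; apply/mnmP => -[].
    move=> pE'; rewrite unfold_in /= /mpoly_unit -pE' eqxx /= unitfE.
    by apply: contraNneq p0 => c0; rewrite pE' c0.
  exists (fun=> 0%N); split=> // [a a0 _|p a b [p0 pU _]]; first exact: unit0.
  by rewrite unit0 in pU.
pose phi : {rmorphism {poly {mpoly K[n]}} -> {mpoly K[n.+1]}} :=
  @horner_morph _ _ (@mwiden n K) 'X_ord_max (fun x => mulrC _ _).
have phiC a : phi a%:P = mwiden a by apply: horner_morphC.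
have phiX : phi 'X = 'X_ord_max by apply: horner_morphX.
have phiK p : @muni n K (phi p) = p.
  elim/poly_ind: p => [|p c IHp]; first by rewrite rmorph0 muni0.
  rewrite rmorphD rmorphM muniD muniM IHp phiX phiC muniXmax; congr (_ + _).
  have := @mpoly_rmorph_eq _ _ (@muni n K \o @mwiden n K) (@polyC {mpoly K[n]}).
  apply=> [a|i] /=; first by rewrite mwidenC muniC.
  by rewrite mwidenX mnmwiden1 muniXwiden.
have muniK p : phi (@muni n K p) = p.
  have := @mpoly_rmorph_eq _ _ (phi \o @muni n K) idfun.
  apply=> [a|i] /=; first by rewrite muniC phiC mwidenC.
  have [[j ->]|->] : (exists j, i = widen_ord (leqnSn n) j) \/ i = ord_max.
    have [lt_in|ge_in] := ltnP i n; [left|right].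
      by exists (Ordinal lt_in); apply: val_inj.
    by apply: val_inj; apply/eqP; rewrite eqn_leq ge_in -ltnS ltn_ord.
  - by rewrite muniXwiden phiC mwidenX mnmwiden1.
  - by rewrite muniXmax phiX.
exists (poly_deg dg \o @muni n K).
exact: (@factorial_iso _ _ phi) phiK muniK (poly_factorial fdg).
Qed.

End MpolyFactorial.

(** * Homogeneous factors *)

Section Homogeneous.
Variables (K : fieldType) (n : nat).
Implicit Types (p q u v : {mpoly K[n]}).

Lemma pihomogM d e p q : p \is d.-homog ->
  pihomog mdeg e (p * q) =
  if (d <= e)%N then p * pihomog mdeg (e - d) q else 0.
Proof.
move=> hp; rewrite {1}(@pihomog_partitionE _ _ mdeg (msize q) q (leqnn _)).
rewrite mulr_sumr raddf_sum /=.
have hpq k : p * pihomog mdeg k q \is (d + k).-homog.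
  by apply: dhomogM => //; apply: pihomogP.
have [le_de|lt_ed] := leqP d e; last first.
  rewrite big1 // => k _; apply: (pihomog_ne0 _ (hpq k)).
  by rewrite gtn_eqF // ltn_addr.
have [lt_s|ge_s] := ltnP (e - d) (msize q).
  rewrite (bigD1 (Ordinal lt_s)) //= pihomog_dE; last first.
    by have := hpq (e - d)%N; rewrite subnKC.
  rewrite big1 ?addr0 // => k; rewrite -val_eqE /= => ne_k.
  apply: (pihomog_ne0 _ (hpq k)).
  by apply: contra ne_k => /eqP <-; rewrite addKn.
rewrite [pihomog mdeg (e - d) q](_ : _ = 0) ?mulr0.
  rewrite big1 // => k _; apply: (pihomog_ne0 _ (hpq k)).
  by apply: contraTneq ge_s => <-; rewrite addKn -ltnNge.
rewrite pihomogE big_seq_cond big1 // => m /andP[/msize_mdeg_lt lt_m /eqP E].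
by move: lt_m; rewrite E ltnNge ge_s.
Qed.

(** Replacing each variable by its product with a new variable T is a ring morphism, and the
    coefficient of T^k in the result is the component of degree k. A form thus becomes a monomial in
    T. *)
Let grade_var (i : 'I_n) : {poly {mpoly K[n]}} := 'X_i *: 'X.
Let grade : {mpoly K[n]} -> {poly {mpoly K[n]}} :=
  mmap (polyC \o @mpolyC n K) grade_var.

Lemma gradeX m : grade 'X_[m] = 'X_[m] *: 'X^(mdeg m).
Proof.
rewrite /grade mmapX /mmap1 mpolyXE_id mdegE -mul_polyC rmorph_prod /=.
rewrite expr_sum -big_split; apply: eq_bigr => i _ /=.
by rewrite /grade_var -mul_polyC exprMn rmorphXn.
Qed.

Lemma coef_grade p k : (grade p)`_k = pihomog mdeg k p.
Proof.
rewrite {1}[p]mpolyE /grade raddf_sum /= coef_sum pihomogE [RHS]big_mkcond /=.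
apply: eq_bigr => m _.
rewrite mmapZ /= -/grade gradeX mul_polyC !coefZ coefXn [k == _]eq_sym.
by case: eqP => _; rewrite ?mulr1 ?mulr0 // mul_mpolyC.
Qed.

Lemma grade_homog d p : p \is d.-homog -> grade p = p *: 'X^d.
Proof.
move=> hp; apply/polyP => k; rewrite coef_grade coefZ coefXn.
have [->|ne_kd] := eqVneq k d; first by rewrite pihomog_dE // mulr1.
by rewrite mulr0 (pihomog_ne0 _ hp) // eq_sym.
Qed.

Lemma monomial_factor (R : idomainType) (p q : {poly R}) c d : c != 0 ->
  p * q = c *: 'X^d -> exists k b, p = b *: 'X^k.
Proof.
move=> c0 E.
have /dvdp_exp_XsubCP[k _ /eqpP[[a b] /= /andP[a0 b0] pE]] : p %| ('X - 0%:P) ^+ d.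
  by rewrite subr0 -(dvdpZr _ _ c0) -E dvdp_mulIl.
rewrite subr0 in pE; exists k, p`_k; apply/polyP => j; rewrite coefZ coefXn.
have [->|ne_jk] := eqVneq j k; first by rewrite mulr1.
apply: (mulfI a0); rewrite -coefZ pE coefZ coefXn (negPf ne_jk).
by rewrite !mulr0.
Qed.

(** Under [grade] the product becomes a monomial in T, and over a domain the factors of a nonzero
    monomial are monomials. *)
Lemma homog_factor d u v : u * v != 0 -> u * v \is d.-homog ->
  exists i j, [/\ (i + j)%N = d, u \is i.-homog & v \is j.-homog].
Proof.
move=> uv0 huv; have := grade_homog huv; rewrite /grade rmorphM /= -/grade => E.
have homog_of w k b : w != 0 -> grade w = b *: 'X^k -> w \is k.-homog.
  move=> w0 wE; have zero e : e != k -> pihomog mdeg e w = 0.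
    by move=> ne; rewrite -coef_grade wE coefZ coefXn (negPf ne) mulr0.
  rewrite homog_piE {2}(@pihomog_partitionE _ _ mdeg (maxn (msize w) k.+1) w) ?leq_maxl //.
  have lt_k : (k < maxn (msize w) k.+1)%N by rewrite leq_max leqnn orbT.
  rewrite (bigD1 (Ordinal lt_k)) //= big1 ?addr0 // => e.
  by rewrite -val_eqE /=; apply: zero.
move: (uv0); rewrite mulf_eq0 negb_or => /andP[u0 v0].
have [a [x uE]] := monomial_factor uv0 E.
have [b [y vE]] := monomial_factor uv0 (etrans (mulrC _ _) E).
exists a, b; have [hu hv] := (homog_of _ _ _ u0 uE, homog_of _ _ _ v0 vE).
by split=> //; apply: dhomog_uniq uv0 _ huv; apply: dhomogM.
Qed.

Lemma homog_cofactor k d u v : u * v != 0 -> u \is k.-homog -> u * v \is d.-homog ->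
  (k <= d)%N /\ v \is (d - k).-homog.
Proof.
move=> uv0 hu huv; have [i [j [ijd hi hv]]] := homog_factor uv0 huv.
move: uv0; rewrite mulf_eq0 negb_or => /andP[u0 _].
by rewrite -ijd -(dhomog_uniq u0 hi hu) leq_addr addKn.
Qed.

Lemma unit_homog0 u : u \is a GRing.unit -> u \is 0.-homog.
Proof.
case/andP=> /eqP -> _; apply/dhomogP => m; rewrite msuppC.
by case: eqP => // _; rewrite inE => /eqP->; apply: mdeg0.
Qed.

Lemma homog0_unit u : u != 0 -> u \is 0.-homog -> u \is a GRing.unit.
Proof.
move=> u0 hu; have uE : u = (u@_0)%:MP.
  apply: msize1_polyC; have := mlead_supp u0; have := mlead_deg u0.
  by move=> <- /(dhomog_mf hu) ->.
rewrite unfold_in /= /mpoly_unit -uE eqxx unitfE.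
by apply: contraNneq u0 => c0; rewrite uE c0.
Qed.

Lemma irreducible_homog_gt0 d (p : {mpoly K[n]}) : irreducible_elt p -> p \is d.-homog -> (0 < d)%N.
Proof.
case=> p0 pU _ hp; rewrite lt0n; apply: contraNneq pU => d0.
by move: hp; rewrite d0; apply: homog0_unit.
Qed.

Lemma irreducible_homog_factor d p : p != 0 -> (0 < d)%N -> p \is d.-homog ->
  exists w e, [/\ irreducible_elt w, w \is e.-homog & divides w p].
Proof.
move=> p0 d0 hp; have [dg fdg] := mpoly_factorial K n.
have pU : p \isn't a GRing.unit.
  by apply: contraTN d0 => /unit_homog0 h0; rewrite (dhomog_uniq p0 hp h0).
have [w irrw [q E]] := irreducible_factor fdg p0 pU.
rewrite E in p0 hp; have [a [b [_ hw _]]] := homog_factor p0 hp.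
by exists w, a; split=> //; exists q.
Qed.

Lemma mpoly_irreducible_prime (w p q : {mpoly K[n]}) : irreducible_elt w ->
  divides w (p * q) -> divides w p \/ divides w q.
Proof. by have [dg [_ _]] := mpoly_factorial K n; apply. Qed.

Lemma irreducible_divides (w w' : {mpoly K[n]}) : irreducible_elt w -> irreducible_elt w' ->
  divides w w' -> divides w' w.
Proof.
move=> [w0 wU _] [w'0 w'U irr] [q E]; have [|] := irr _ _ E; first by rewrite (negPf wU).
by move=> /unitrP[r [_ rq]]; exists r; rewrite E -mulrA rq mulr1.
Qed.

Lemma linear_irreducible p : p != 0 -> p \is 1.-homog -> irreducible_elt p.
Proof.
move=> p0 hp; split=> // [|b c E].
  by apply/negP => /unit_homog0 h0; have := dhomog_uniq p0 hp h0.
rewrite E in p0 hp; have [a [a' [+ hb hc]]] := homog_factor p0 hp.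
move: p0; rewrite mulf_eq0 negb_or => /andP[b0 c0].
case: a hb => [hb _|a hb]; first by left; apply: homog0_unit.
rewrite addSn => -[/eqP]; rewrite addn_eq0 => /andP[_ /eqP a'0].
by right; move: hc; rewrite a'0; apply: homog0_unit.
Qed.

Lemma mpolyX_homog i : 'X_i \is [in K[n], 1.-homog].
Proof. by rewrite dhomogX /= mdeg1. Qed.

Lemma mpolyXn_homog i k : 'X_i ^+ k \is [in K[n], k.-homog].
Proof. by have := dhomogMn k (mpolyX_homog i); rewrite mul1n. Qed.

Lemma mpolyX_irreducible i : irreducible_elt ('X_i : {mpoly K[n]}).
Proof.
apply: linear_irreducible; last exact: mpolyX_homog.
by rewrite -msize_poly_eq0 msizeX mdeg1.
Qed.

End Homogeneous.

(** * Pencils of linear maps *)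

Section Spaces.
Variable K : fieldType.

(** A subspace of maximal dimension among those inside [S] is all of [S], since adjoining a missing
    vector would enlarge it. *)
Lemma vspace_of_prop (V : vectType K) (S : V -> Prop) :
  S 0 -> (forall u v, S u -> S v -> S (u + v)) -> (forall a u, S u -> S (a *: u)) ->
  exists U : {vspace V}, forall v, v \in U <-> S v.
Proof.
move=> S0 SD SZ.
pose P k := `[< exists2 U : {vspace V}, (forall v, v \in U -> S v) & \dim U = k >].
have exP : exists k, P k.
  exists 0%N; apply/asboolP; exists 0%VS; last exact: dimv0.
  by move=> v; rewrite memv0 => /eqP->.
have ubP k : P k -> (k <= \dim {:V})%N.
  by move/asboolP => [U _ <-]; apply: dimvS; apply: subvf.
case: (ex_maxnP exP ubP) => k /asboolP[U US dimU] maxk.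
exists U => v; split=> [/US//|Sv]; apply: contrapT => /negP nUv.
have : P (\dim (U + <[v]>)).
  apply/asboolP; exists (U + <[v]>)%VS => // w /memv_addP[u uU [z /vlineP[a ->] ->]].
  by apply: SD; [apply: US|apply: SZ].
move/maxk; rewrite leqNgt -dimU => /negP; apply.
rewrite (ltn_leqif (dimv_leqif_sup _)) ?addvSl //.
by apply: contra nUv => /subvP; apply; apply: (subvP (addvSr _ _)); apply: memv_line.
Qed.

(** [f] induces a surjection from V/X onto W/J. *)
Lemma codim_image_le (V W : vectType K) (f : 'Hom(V, W)) (X : {vspace V}) (J : {vspace W}) :
  (f @: X <= J)%VS -> (J + limg f)%VS = fullv ->
  (\dim {:W} - \dim J <= \dim {:V} - \dim X)%N.
Proof.
move=> fX full.
have : ({:W} <= J + f @: X^C)%VS.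
  rewrite -full subv_add addvSl /= -(addv_complf X) limgD subv_add.
  by rewrite addvSr (subv_trans fX) ?addvSl.
move=> /dimvS le1; rewrite -(dimv_compl X) leq_subLR (leq_trans le1) //.
rewrite (leq_trans (dimv_add_leqif _ _)) // leq_add2l.
by rewrite -(limg_ker_dim f) leq_addl.
Qed.

End Spaces.

Section Eigen.
Variable K : closedFieldType.

Lemma stable_eigenvector (V : vectType K) (T : 'End(V)) (C : {vspace V}) :
  (T @: C <= C)%VS -> C != 0%VS ->
  exists a u, [/\ u \in C, u != 0 & T u = a *: u].
Proof.
move=> TC C0; set b := vbasis C.
have bC i : b`_i \in C.
  have [lt_i|ge_i] := ltnP i (size b); last by rewrite nth_default ?mem0v.
  by apply: vbasis_mem; apply: mem_nth.
pose M : 'M[K]_(\dim C) := \matrix_(i, j) coord b j (T b`_i).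
have [a Ma] : exists a, root (char_poly M) a.
  by apply/closed_rootP; rewrite size_char_poly eqSS dimv_eq0.
move: Ma; rewrite -eigenvalue_root_char => /eigenvalueP[x xM x0].
exists a, (\sum_i x 0 i *: b`_i); split.
- by apply: rpred_sum => i _; apply: rpredZ.
- apply: contraNneq x0 => xz; have {}xz := freeP (basis_free (vbasisP C)) (fun i => x 0 i) xz.
  by apply/eqP/rowP => i; rewrite mxE xz.
rewrite linear_sum scaler_sumr /=.
transitivity (\sum_i x 0 i *: \sum_j M i j *: b`_j).
  apply: eq_bigr => i _; rewrite linearZ /=; congr (_ *: _).
  rewrite {1}(@coord_vbasis _ _ (T b`_i) C).
    by apply: eq_bigr => j _; rewrite mxE.
  by apply: (subvP TC); apply: memv_img.
under [LHS]eq_bigr do rewrite scaler_sumr.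
rewrite exchange_big; apply: eq_bigr => j _ /=.
under [LHS]eq_bigr do rewrite scalerA.
by rewrite -scaler_suml scalerA; move/rowP/(_ j): xM; rewrite !mxE => ->.
Qed.

(** By the injectivity hypothesis and the equality of codimensions, [g] maps the complement of [I]
    isomorphically onto a complement of [J]. The required [u] is an eigenvector there of the inverse
    of [g] after [f], taken modulo [J]. *)
Lemma pencil_eigenvector (V W : vectType K) (I : {vspace V}) (J : {vspace W})
    (f g : 'Hom(V, W)) :
  (forall u, g u \in J -> u \in I) -> I != fullv ->
  (\dim {:W} - \dim J = \dim {:V} - \dim I)%N ->
  exists a u, u \notin I /\ f u - a *: g u \in J.
Proof.
move=> ginj I_proper dimE.
have capC : (I^C :&: lker g = 0)%VS.
  apply/eqP; rewrite -subv0; apply/subvP => u /memv_capP[uC uk].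
  rewrite memv0 -memv0 -(capv_compl I) memv_cap uC andbT.
  by apply: ginj; move: uk; rewrite memv_ker => /eqP->; apply: mem0v.
have capJ : (g @: I^C :&: J = 0)%VS.
  apply/eqP; rewrite -subv0; apply/subvP => w /memv_capP[/memv_imgP[u uC ->] uJ].
  rewrite memv0; have : u \in (I :&: I^C)%VS by rewrite memv_cap uC andbT ginj.
  by rewrite capv_compl memv0 => /eqP->; rewrite linear0.
have full : (g @: I^C + J = fullv)%VS.
  apply/eqP; rewrite eqEdim subvf /= dimv_disjoint_sum // limg_dim_eq //.
  by rewrite dimv_compl -dimE subnK // dimvS ?subvf.
(* [T] must be an endomorphism of V, so the inverse is that of [g] composed with the projection to
   [I^C], and its result is projected to [I^C] again. *)
pose g' := (g \o projv I^C)%VF.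
pose T := (projv I^C \o (g'^-1 \o (daddv_pi (g @: I^C) J \o f)))%VF.
have TC u : T u \in (I^C)%VS by rewrite /T comp_lfunE /= /projv memv_pi.
have gT u : g (T u) = daddv_pi (g @: I^C) J (f u).
  rewrite /T !comp_lfunE /=; set w := daddv_pi _ _ _.
  have -> v : g (projv I^C v) = g' v by rewrite comp_lfunE.
  apply: limg_lfunVK; have /memv_imgP[v vC ->] : w \in (g @: I^C)%VS by apply: memv_pi.
  have -> : g v = g' v by rewrite comp_lfunE /= projv_id.
  exact/memv_img/memvf.
have [a [u [uC u0 Tu]]] : exists a u, [/\ u \in (I^C)%VS, u != 0 & T u = a *: u].
  apply: stable_eigenvector; first by apply/subvP => _ /memv_imgP[u _ ->].
  by apply: contra I_proper => /eqP C0; rewrite -[I]addv0 -C0 addv_complf.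
exists a, u; split.
  apply: contra u0 => uI; have : u \in (I :&: I^C)%VS by rewrite memv_cap uI.
  by rewrite capv_compl memv0.
rewrite -linearZ /= -Tu gT.
have fuf : f u \in (g @: I^C + J)%VS by rewrite full memvf.
by rewrite -{1}(daddv_pi_add capJ fuf) addrC addKr memv_pi.
Qed.

End Eigen.

(** * Graded ideals *)

Section GradedIdeals.
Variables (K : closedFieldType) (n : nat).
Implicit Types (p q u v l : {mpoly K[n.+1]}) (I : {mpoly K[n.+1]} -> Prop).

Definition graded_ideal I : Prop :=
  [/\ I 0, forall p q, I p -> I q -> I (p + q), forall p q, I q -> I (p * q) &
      forall e p, I p -> I (pihomog mdeg e p)].

Definition contains_degree I (N : nat) : Prop := forall p, p \is N.-homog -> I p.

(** For a graded ideal: no power of the irrelevant ideal is contained in [I], since containing one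
    degree entails containing all higher ones. *)
Definition proper_ideal I : Prop := forall N, ~ contains_degree I N.

Definition add_gen I l : {mpoly K[n.+1]} -> Prop :=
  fun p => exists u v, I u /\ p = u + l * v.

Lemma add_gen_graded I l : graded_ideal I -> l \is 1.-homog ->
  graded_ideal (add_gen I l).
Proof.
move=> [I0 ID IM Ipi] hl; split=> [|p q|p q|e p].
- by exists 0, 0; rewrite mulr0 addr0.
- move=> [u [v [uI ->]]] [u' [v' [u'I ->]]]; exists (u + u'), (v + v').
  by split; [apply: ID|rewrite mulrDr addrACA].
- move=> [u [v [uI ->]]]; exists (p * u), (p * v).
  by split; [apply: IM|rewrite mulrDr mulrCA].
move=> [u [v [uI ->]]]; rewrite raddfD /= (pihomogM _ _ hl).
exists (pihomog mdeg e u), (if (0 < e)%N then pihomog mdeg (e - 1) v else 0).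
by split; [apply: Ipi|case: ifP => _ //; rewrite mulr0].
Qed.

Lemma graded_scale I c p : graded_ideal I -> I p -> I (c *: p).
Proof. by case=> _ _ IM _ Ip; rewrite -mul_mpolyC; apply: IM. Qed.

Lemma graded_sub I p q : graded_ideal I -> I p -> I q -> I (p - q).
Proof.
move=> gI Ip Iq; have [_ ID _ _] := gI; apply: ID => //.
by rewrite -scaleN1r; apply: graded_scale.
Qed.

Lemma graded_sum I (T : Type) (r : seq T) (P : pred T) (F : T -> {mpoly K[n.+1]}) :
  graded_ideal I -> (forall i, P i -> I (F i)) -> I (\sum_(i <- r | P i) F i).
Proof. by case=> I0 ID _ _ IF; apply: (big_ind I). Qed.

Lemma mnm_split_degree (m : 'X_{1..n.+1}) N : (N <= mdeg m)%N ->
  exists m1 m2, m = (m1 + m2)%MM /\ mdeg m1 = N.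
Proof.
elim: N => [_|N IHN lt_N]; first by exists 0%MM, m; rewrite add0m mdeg0.
have [m1 [m2 [mE dm1]]] := IHN (ltnW lt_N).
have m20 : m2 != 0%MM.
  by apply: contraTneq lt_N => m20; rewrite mE m20 addm0 dm1 ltnn.
have [i m2i] : exists i, m2 i != 0%N.
  apply/existsP; apply: contraNT m20; rewrite negb_exists => /forallP m2z.
  by apply/eqP/mnmP => i; have := m2z i; rewrite negbK mnm0E => /eqP.
exists (m1 + U_(i))%MM, (m2 - U_(i))%MM; split; last by rewrite mdegD mdeg1 dm1 addn1.
by rewrite mE -addmA; congr (_ + _)%MM; rewrite addmC submK // lep1mP.
Qed.

Lemma contains_degree_up I N M : graded_ideal I -> (N <= M)%N ->
  contains_degree I N -> contains_degree I M.
Proof.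
move=> gI le_NM IN p hp; have [_ _ IM _] := gI.
rewrite [p]mpolyE big_seq; apply: graded_sum => // m /(dhomog_mf hp) dm.
apply: graded_scale => //.
have [m1 [m2 [-> dm1]]] := mnm_split_degree (leq_trans le_NM (eq_leq (esym dm))).
by rewrite mpolyXD mulrC; apply: IM; apply: IN; rewrite dhomogX; apply/eqP.
Qed.

Section Pieces.
Variables (I : {mpoly K[n.+1]} -> Prop) (gI : graded_ideal I).

Lemma piece_exists N : {U : {vspace dhomog n.+1 K N} | forall v : dhomog n.+1 K N, v \in U <-> I v}.
Proof.
apply: cid; have [I0 ID _ _] := gI.
apply: (vspace_of_prop (S := fun v : dhomog n.+1 K N => I v)) => // [u v|c u].
  exact: ID.
exact: graded_scale.
Qed.

Definition piece N : {vspace dhomog n.+1 K N} := sval (piece_exists N).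

Lemma pieceP N (v : dhomog n.+1 K N) : v \in piece N <-> I v.
Proof. exact: (svalP (piece_exists N)). Qed.

Lemma contains_degreeE N : contains_degree I N <-> piece N = fullv.
Proof.
split=> [IN|full p hp].
  apply/eqP; rewrite eqEsubv subvf /=; apply/subvP => v _; apply/pieceP.
  by apply: IN; case: v.
by have := memvf (DHomog hp); rewrite -full => /pieceP.
Qed.

(** The Hilbert function of the quotient by [I]. *)
Definition codim N := (\dim {: dhomog n.+1 K N} - \dim (piece N))%N.

End Pieces.

Section Multiplication.
Variables (l : {mpoly K[n.+1]}) (hl : l \is 1.-homog) (N : nat).

Definition mul_form (v : dhomog n.+1 K N) : dhomog n.+1 K N.+1 :=
  DHomog (dhomogM hl (dhomog_is_dhomog v)).

Lemma mul_form_linear : linear mul_form.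
Proof. by move=> c u v; apply: val_inj; rewrite /= mulrDr -scalerAr. Qed.

HB.instance Definition _ := GRing.isLinear.Build K (dhomog n.+1 K N) (dhomog n.+1 K N.+1)
  _ mul_form mul_form_linear.

Definition mul_hom := linfun mul_form.

Lemma mul_homE (v : dhomog n.+1 K N) : mul_hom v = l * v :> {mpoly K[n.+1]}.
Proof. by rewrite /mul_hom lfunE. Qed.

Variables (I : {mpoly K[n.+1]} -> Prop) (gI : graded_ideal I).
Hypothesis full : contains_degree (add_gen I l) N.+1.

Lemma piece_mul_full : (piece gI N.+1 + limg mul_hom)%VS = fullv.
Proof.
have [_ _ _ Ipi] := gI.
apply/eqP; rewrite eqEsubv subvf /=; apply/subvP => w _.
have [u [v [uI wE]]] := full (dhomog_is_dhomog w).
have hu := pihomogP mdeg N.+1 u; have hv := pihomogP mdeg N v.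
have -> : w = DHomog hu + mul_hom (DHomog hv).
  apply: val_inj => /=; rewrite mul_homE /= -(pihomog_dE (dhomog_is_dhomog w)).
  by rewrite wE raddfD /= (pihomogM _ _ hl) subSS subn0.
apply: memv_add; last exact/memv_img/memvf.
by apply/pieceP; apply: Ipi.
Qed.

(** Multiplication by [l] maps degree N of the quotient by [I] onto degree N + 1. *)
Lemma codim_le : (codim gI N.+1 <= codim gI N)%N.
Proof.
apply: (codim_image_le _ piece_mul_full).
apply/subvP => _ /memv_imgP[u /pieceP uI ->]; apply/pieceP.
by rewrite mul_homE; case: gI => _ _ IM _; apply: IM.
Qed.

(** A surjection between spaces of equal dimension is injective: a kernel element outside [I] would
    enlarge the source subspace and make the codimension drop strictly. *)
Lemma mul_inj_of_codim : codim gI N.+1 = codim gI N ->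
  forall v : dhomog n.+1 K N, I (l * v) -> I v.
Proof.
move=> eqc v lv; apply: contrapT => nvI.
have nv : v \notin piece gI N by apply/negP => /pieceP.
have dimX : (\dim (piece gI N) < \dim (piece gI N + <[v]>))%N.
  rewrite (ltn_leqif (dimv_leqif_sup _)) ?addvSl //.
  by apply: contra nv => /subvP; apply; apply: (subvP (addvSr _ _)); apply: memv_line.
have [_ ID IM _] := gI.
have fX : (mul_hom @: (piece gI N + <[v]>) <= piece gI N.+1)%VS.
  apply/subvP => _ /memv_imgP[_ /memv_addP[u /pieceP uI [w /vlineP[c ->] ->]] ->].
  apply/pieceP; rewrite mul_homE /= mulrDr; apply: ID; first exact: IM.
  by rewrite -scalerAr; apply: graded_scale.
have := codim_image_le fX piece_mul_full.
apply/negP; rewrite -ltnNge -/(codim gI N.+1) eqc /codim ltn_sub2l //.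
by apply: leq_trans dimX _; apply/dimvS/subvf.
Qed.

End Multiplication.
End GradedIdeals.

Section Nullstellensatz.
Variables (K : closedFieldType) (n : nat).
Implicit Types (p q u v l : {mpoly K[n.+1]}) (I : {mpoly K[n.+1]} -> Prop).

Lemma add_gen_sub I l p : I p -> add_gen I l p.
Proof. by move=> Ip; exists p, 0; rewrite mulr0 addr0. Qed.

Lemma add_gen_gen I l : graded_ideal I -> add_gen I l l.
Proof. by case=> I0 _ _ _; exists 0, 1; rewrite add0r mulr1. Qed.

Lemma improper_exists I : ~ proper_ideal I -> exists N, contains_degree I N.
Proof. by move=> nI; apply: contrapT => nex; apply: nI => N IN; apply: nex; exists N. Qed.

(** From the degree filled by I + (l) on, the Hilbert function does not increase, so it is constant
    once it has reached its minimum. *)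
Lemma codim_stable I l : graded_ideal I -> l \is 1.-homog ->
  ~ proper_ideal (add_gen I l) ->
  exists N1, forall (gI : graded_ideal I) N, (N1 <= N)%N ->
    codim gI N.+1 = codim gI N /\ contains_degree (add_gen I l) N.+1.
Proof.
move=> gI hl /improper_exists[N0 IN0].
have full N : (N0 <= N)%N -> contains_degree (add_gen I l) N.
  by move=> le_N; apply: contains_degree_up le_N IN0; apply: add_gen_graded.
pose P k := `[< exists2 N, (N0 <= N)%N & codim gI N = k >].
have exP : exists k, P k by exists (codim gI N0); apply/asboolP; exists N0.
case: (ex_minnP exP) => k /asboolP[N1 le_N1 <-] mink.
have const N : (N1 <= N)%N -> codim gI N = codim gI N1.
  elim: N => [|N IHN]; first by rewrite leqn0 => /eqP->.
  rewrite leq_eqVlt => /orP[/eqP->//|]; rewrite ltnS => le_N.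
  apply/eqP; rewrite eqn_leq -{1}(IHN le_N) (codim_le hl) /=; last first.
    by apply: full; apply: leq_trans le_N1 _; apply: leqW.
  apply: mink; apply/asboolP; exists N.+1 => //.
  by apply: leq_trans le_N1 _; apply: leqW.
exists N1 => gI' N le_N; rewrite (Prop_irrelevance gI' gI) !const ?leqW //.
by split=> //; apply: full; apply: leq_trans le_N1 _; apply: leqW.
Qed.

(* If every I + (l1 - a l2) were improper, multiplication by each of them would be
   bijective on the quotient in large degree, where l2^-1 l1 has an eigenvalue. *)
Lemma proper_pencil I l1 l2 : graded_ideal I -> proper_ideal I ->
  l1 \is 1.-homog -> l2 \is 1.-homog ->
  proper_ideal (add_gen I l2) \/ exists a, proper_ideal (add_gen I (l1 - a *: l2)).
Proof.
move=> gI pI h1 h2; apply: contrapT => /not_orP[np2 /forallNP np].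
have [N1 stable] := codim_stable gI h2 np2.
have cE N : (N1 <= N)%N -> codim gI N.+1 = codim gI N by move/(stable gI) => [].
have inj2 N (le_N : (N1 <= N)%N) := mul_inj_of_codim h2 (stable gI N le_N).2 (cE N le_N).
have [a [u [nu]]] : exists a (u : dhomog n.+1 K N1), u \notin piece gI N1 /\
    mul_hom h1 N1 u - a *: mul_hom h2 N1 u \in piece gI N1.+1.
  apply: pencil_eigenvector.
  - by move=> u /pieceP; rewrite mul_homE => /(inj2 _ (leqnn _)) /pieceP.
  - by apply/eqP => /contains_degreeE; apply: pI.
  - exact: cE.
move=> /pieceP uI'; have uI : I ((l1 - a *: l2) * u).
  by rewrite mulrBl -scalerAl -(mul_homE h1) -(mul_homE h2).
have h12 : l1 - a *: l2 \is 1.-homog.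
  by apply: rpredB => //; apply: rpredZ.
have [N2 stable2] := codim_stable gI h12 (np a).
have inj12 N (le_N : (N2 <= N)%N) :=
  mul_inj_of_codim h12 (stable2 gI N le_N).2 (stable2 gI N le_N).1.
have hk k : l2 ^+ k * u \is (k + N1).-homog.
  apply: dhomogM (dhomog_is_dhomog u).
  by have := dhomogMn k h2; rewrite mul1n.
(* The degree N1 of [u] may lie below the range where [l1 - a *: l2] is injective. Multiplying by a
   power of [l2] moves into that range; the power is then cancelled factor by factor. *)
have big : I (l2 ^+ N2 * u).
  apply: (inj12 _ (leq_addr N1 N2) (DHomog (hk N2))) => /=.
  by rewrite mulrCA; have [_ _ IM _] := gI; apply: IM.
suff : I (l2 ^+ 0 * u) by rewrite mul1r => Iu; move/negP: nu; apply; apply/pieceP.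
elim: (N2) big => // k IHk; rewrite exprS -mulrA => /(inj2 (k + N1)%N _ (DHomog (hk k))).
by rewrite leq_addl => /(_ isT).
Qed.

(** The coordinates of a zero are found one at a time: modulo [J], every variable up to index j is a
    scalar multiple of a pivot variable, whose own coordinate is normalized to 1. *)
Lemma proper_point_step I (j : nat) : (j <= n)%N -> graded_ideal I -> proper_ideal I ->
  exists J (i0 : 'I_n.+1) (z : 'I_n.+1 -> K),
    [/\ graded_ideal J, proper_ideal J, forall p, I p -> J p, (i0 <= j)%N /\ z i0 = 1 &
        forall i : 'I_n.+1, (i <= j)%N -> J ('X_i - z i *: 'X_i0)].
Proof.
move=> + gI pI; have hX (i : 'I_n.+1) : ('X_i : {mpoly K[n.+1]}) \is 1.-homog.
  by rewrite dhomogX /= mdeg1.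
elim: j => [_|j IHj lt_jn].
  exists I, ord0, (fun=> 1); split=> // i; rewrite leqn0 => /eqP i0.
  by rewrite (_ : i = ord0) ?scale1r ?subrr; [case: gI|apply: val_inj].
have [J [i0 [z [gJ pJ IJ [le_i0 zi0] Jz]]]] := IHj (ltnW lt_jn).
pose i1 : 'I_n.+1 := Ordinal (lt_jn : (j.+1 < n.+1)%N).
have ne_i (i : 'I_n.+1) : (i <= j)%N -> (i == i1) = false.
  by move=> le_ij; apply/eqP => ii1; move: le_ij; rewrite ii1 ltnn.
have [pJ'|[c pJ']] := proper_pencil gJ pJ (hX i1) (hX i0).
  (* Here the old pivot itself becomes 0, so all earlier coordinates vanish and the new variable
     takes over as pivot. *)
  exists (add_gen J 'X_i0), i1, (fun i => (i == i1)%:R).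
  have gJ' := add_gen_graded gJ (hX i0).
  split=> //; first by move=> p Ip; apply/add_gen_sub/IJ.
    by rewrite eqxx.
  move=> i; rewrite leq_eqVlt => /orP[/eqP ij|le_ij].
    have -> : i = i1 by apply: val_inj.
    by rewrite eqxx scale1r subrr; case: gJ'.
  rewrite ne_i // scale0r subr0 -(subrK (z i *: 'X_i0) 'X_i).
  have [_ JD _ _] := gJ'; apply: JD; first by apply: add_gen_sub; apply: Jz.
  by apply: graded_scale => //; apply: add_gen_gen.
have hl : 'X_i1 - c *: 'X_i0 \is [in K[n.+1], 1.-homog].
  by apply: rpredB => //; apply: rpredZ.
exists (add_gen J ('X_i1 - c *: 'X_i0)), i0, (fun i => if i == i1 then c else z i).
split; [exact: add_gen_graded|by []|by move=> p Ip; apply/add_gen_sub/IJ| |].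
  by rewrite ne_i // (leq_trans le_i0).
move=> i; rewrite leq_eqVlt => /orP[/eqP ij|le_ij].
  have -> : i = i1 by apply: val_inj.
  by rewrite eqxx; apply: add_gen_gen.
by rewrite ne_i //; apply: add_gen_sub; apply: Jz.
Qed.

Lemma graded_monomial I (i0 : 'I_n.+1) z : graded_ideal I ->
  (forall i, I ('X_i - z i *: 'X_i0)) ->
  forall m, I ('X_[m] - 'X_[m].@[z] *: 'X_i0 ^+ mdeg m).
Proof.
move=> gI Iz m; have [I0 ID IM _] := gI.
have cong p1 q1 p2 q2 : I (p1 - q1) -> I (p2 - q2) -> I (p1 * p2 - q1 * q2).
  move=> I1 I2; rewrite -(subrK (q1 * p2) (p1 * p2)) -mulrBl -addrA -mulrBr.
  by apply: ID; [rewrite mulrC|]; apply: IM.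
rewrite mevalX mpolyXE_id -mul_mpolyC rmorph_prod mdegE expr_sum -big_split /=.
apply: (big_ind2 (fun p q => I (p - q))); first by rewrite subrr.
- by move=> p1 q1 p2 q2; apply: cong.
move=> i _; rewrite rmorphXn -exprMn; elim: (m i) => [|k IHk]; first by rewrite !expr0 subrr.
by rewrite !exprS; apply: cong => //; rewrite mul_mpolyC.
Qed.

(** Modulo [J] a form p of degree e is congruent to p(z) times the e-th power of the pivot. If p(z)
    were nonzero, that power and then every monomial of degree e would lie in [J], against
    properness. *)
Theorem graded_nullstellensatz I : graded_ideal I -> proper_ideal I ->
  exists z : 'I_n.+1 -> K, (exists i, z i != 0) /\
    forall e p, p \is e.-homog -> I p -> p.@[z] = 0.
Proof.
move=> gI pI; have [J [i0 [z [gJ pJ IJ [_ zi0] Jz]]]] := proper_point_step (leqnn n) gI pI.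
have {}Jz i : J ('X_i - z i *: 'X_i0) by apply: Jz; rewrite -ltnS.
have Jm := graded_monomial gJ Jz.
exists z; split=> [|e p hp Ip]; first by exists i0; rewrite zi0 oner_eq0.
apply: contrapT => /eqP pz0.
have JX : J ('X_i0 ^+ e).
  have : J (p.@[z] *: 'X_i0 ^+ e).
    have [_ JD _ _] := gJ.
    suff Jp : J (p - p.@[z] *: 'X_i0 ^+ e).
      rewrite -[_ *: _](subKr p); apply: graded_sub => //; exact: IJ.
    rewrite {1 2}[p]mpolyE raddf_sum /= scaler_suml -sumrB big_seq.
    apply: graded_sum => // m /(dhomog_mf hp) dm.
    by rewrite mevalZ -scalerA -scalerBr; apply: graded_scale => //; rewrite -dm.
  by move/(graded_scale (p.@[z])^-1 gJ); rewrite scalerA mulVf // scale1r.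
apply: (pJ e) => q hq; rewrite [q]mpolyE big_seq; apply: graded_sum => // m /(dhomog_mf hq) dm.
apply: graded_scale => //; rewrite -(subrK ('X_[m].@[z] *: 'X_i0 ^+ mdeg m) 'X_[m]).
have [_ JD _ _] := gJ; apply: JD => //; apply: graded_scale => //.
by have -> : mdeg m = e.
Qed.

End Nullstellensatz.

(** * Polynomial maps and elimination *)

Definition coords (K : fieldType) (V : vectType K) (v : V) (i : 'I_(\dim {:V})) : K :=
  coord (vbasis {:V}) i v.

Section PolyMap.
Variables (K : fieldType) (V : vectType K).

(* [io] is the structure map of the K-algebra B; [e] is the degree in the coordinates of V. *)
Definition polymap (B : comNzRingType) (io : {rmorphism K -> B}) (e : nat) (f : V -> B) : Prop :=
  exists2 P : {mpoly B[\dim {:V}]}, P \is e.-homog & forall v, f v = P.@[io \o coords v].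

Section Closure.
Variables (B : comNzRingType) (io : {rmorphism K -> B}).

Lemma polymap_ext e f g : f =1 g -> polymap io e f -> polymap io e g.
Proof. by move=> fg [P hP fE]; exists P => // v; rewrite -fg. Qed.

Lemma polymap0 e : polymap io e (fun=> 0).
Proof. by exists 0 => [|v]; rewrite ?dhomog0 ?meval0. Qed.

Lemma polymap_const c : polymap io 0 (fun=> c).
Proof.
exists c%:MP => [|v]; last by rewrite mevalC.
apply/dhomogP => m; rewrite msuppC.
by case: eqP => // _; rewrite inE => /eqP->; apply: mdeg0.
Qed.

Lemma polymapD e f g : polymap io e f -> polymap io e g ->
  polymap io e (fun v => f v + g v).
Proof.
move=> [P hP fE] [Q hQ gE]; exists (P + Q) => [|v]; first exact: dhomogD.
by rewrite mevalD fE gE.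
Qed.

Lemma polymapM e1 e2 f g : polymap io e1 f -> polymap io e2 g ->
  polymap io (e1 + e2) (fun v => f v * g v).
Proof.
move=> [P hP fE] [Q hQ gE]; exists (P * Q) => [|v]; first exact: dhomogM.
by rewrite mevalM fE gE.
Qed.

Lemma polymapZ e c f : polymap io e f -> polymap io e (fun v => c * f v).
Proof. by move/(polymapM (polymap_const c)). Qed.

Lemma polymapN e f : polymap io e f -> polymap io e (fun v => - f v).
Proof. by move/(polymapZ (-1)); apply: polymap_ext => v; rewrite mulN1r. Qed.

Lemma polymap_sum (T : Type) (r : seq T) (P : pred T) e (f : T -> V -> B) :
  (forall t, polymap io e (f t)) -> polymap io e (fun v => \sum_(t <- r | P t) f t v).
Proof.
move=> hf; elim: r => [|t r IHr].
  by apply: polymap_ext (polymap0 e) => v; rewrite big_nil.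
case Pt: (P t); last by apply: polymap_ext IHr => v; rewrite big_cons Pt.
by apply: polymap_ext (polymapD (hf t) IHr) => v; rewrite big_cons Pt.
Qed.

Lemma polymap_prod (T : Type) (r : seq T) e (f : T -> V -> B) :
  (forall t, polymap io e (f t)) ->
  polymap io (size r * e) (fun v => \prod_(t <- r) f t v).
Proof.
move=> hf; elim: r => [|t r IHr].
  by rewrite mul0n; apply: polymap_ext (polymap_const 1) => v; rewrite big_nil.
by rewrite /= mulSn; apply: polymap_ext (polymapM (hf t) IHr) => v; rewrite big_cons.
Qed.

Lemma polymap_det k e (A : V -> 'M[B]_k) :
  (forall i j, polymap io e (fun v => A v i j)) -> polymap io (k * e) (fun v => \det (A v)).
Proof.
move=> hA; apply: polymap_sum => s; apply: polymapZ.
by have := polymap_prod (index_enum 'I_k) (fun i => hA i (s i));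
  rewrite -sum1_size big_const_ord iter_addn_0 mul1n.
Qed.

Lemma polymap_linear (f : V -> B) : {morph f : u v / u + v} ->
  (forall c v, f (c *: v) = io c * f v) -> polymap io 1 f.
Proof.
move=> fD fZ; set b := vbasis {:V}.
have f0 : f 0 = 0 by have := fZ 0 0; rewrite scale0r rmorph0 mul0r.
exists (\sum_(i < \dim {:V}) f b`_i *: 'X_i) => [|v].
  by apply: rpred_sum => i _; apply: rpredZ; rewrite dhomogX /= mdeg1.
rewrite {1}(coord_vbasis (memvf v)) (big_morph f fD f0) raddf_sum /=.
by apply: eq_bigr => i _; rewrite fZ mevalZ mevalXU mulrC.
Qed.

End Closure.

(** [h] is only K-linear, for instance the extraction of a coefficient, so it is applied to the
    coefficients of the representing polynomial. *)
Lemma polymap_map (B C : comNzRingType) (io : {rmorphism K -> B}) (io' : {rmorphism K -> C})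
    (h : {additive B -> C}) e f :
  (forall c b, h (io c * b) = io' c * h b) -> polymap io e f -> polymap io' e (h \o f).
Proof.
move=> hZ [P hP fE]; exists (\sum_(m <- msupp P) h P@_m *: 'X_[m]) => [|v].
  rewrite big_seq; apply: rpred_sum => m /(dhomog_mf hP) dm.
  by apply: rpredZ; rewrite dhomogX; apply/eqP.
rewrite /= fE mevalE !raddf_sum /=; apply: eq_bigr => m _.
rewrite mevalZ mevalX.
have prodE (D : comNzRingType) (j : {rmorphism K -> D}) :
    \prod_i (j \o coords v) i ^+ m i = j (\prod_i coords v i ^+ m i).
  by rewrite rmorph_prod; apply: eq_bigr => i _; rewrite rmorphXn.
by rewrite !prodE mulrC hZ mulrC.
Qed.

Lemma polymap_mcoeff m e (f : V -> {mpoly K[m]}) x :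
  polymap (@mpolyC m K) e f -> polymap idfun e (fun v => (f v)@_x).
Proof.
move=> hf; apply: (polymap_map (h := mcoeff x) (io' := idfun) _ hf).
by move=> c b; rewrite /= mul_mpolyC; apply: mcoeffZ.
Qed.

Lemma polymap_scale m e (f : V -> K) (p : {mpoly K[m]}) :
  polymap idfun e f -> polymap (@mpolyC m K) e (fun v => f v *: p).
Proof.
move=> hf.
have hfC := polymap_map (h := @mpolyC m K) (io := idfun) (io' := @mpolyC m K)
  (@mpolyCM m K) hf.
apply: polymap_ext (polymapZ p hfC) => v /=.
by rewrite mulrC mul_mpolyC.
Qed.

End PolyMap.

(** * Closed sets through separating polynomials *)

Section Separation.
Variables (K : fieldType) (V : vectType K).

Definition polyfun (e : nat) (f : V -> K) : Prop := polymap idfun e f.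

(** [S] is an intersection of zero sets of homogeneous polynomial functions. The function may depend
    on the point, which fits the arbitrary families of equations in [proj_closed]. *)
Definition separated (S : V -> Prop) : Prop :=
  forall v0, ~ S v0 -> exists e f,
    [/\ polyfun e f, f v0 != 0 & forall v, S v -> f v = 0].

Lemma separated_union (k : nat) (S : nat -> V -> Prop) :
  (forall i, (i < k)%N -> separated (S i)) ->
  separated (fun v => exists i, (i < k)%N /\ S i v).
Proof.
elim: k => [|k IHk] sepS v0 nS.
  exists 0%N, (fun=> 1); split; [exact: polymap_const|exact: oner_neq0|].
  by move=> v [i []].
have [|e1 [f1 [h1 f10 f1S]]] := sepS k (leqnn _) v0.
  by move=> Sk; apply: nS; exists k.
have [|e2 [f2 [h2 f20 f2S]]] := IHk (fun i lt_i => sepS i (ltnW lt_i)) v0.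
  by move=> [i [lt_i Si]]; apply: nS; exists i; split=> //; apply: ltnW.
exists (e1 + e2)%N, (fun v => f1 v * f2 v); split; first exact: polymapM.
  by rewrite mulf_neq0.
move=> v [i [lt_i Si]]; move: lt_i Si; rewrite ltnS leq_eqVlt => /orP[/eqP-> Si|lt_i Si].
  by rewrite f1S ?mul0r.
by rewrite f2S ?mulr0 //; exists i.
Qed.

Lemma separated_closed (S : V -> Prop) :
  separated S -> proj_closed [set x : projective V | S (repr_vec x)].
Proof.
move=> sepS.
exists [set P | (exists e, P \is e.-homog) /\ forall v, S v -> P.@[coords v] = 0].
  by move=> P [].
apply/seteqP; split=> x /= Sx; first by move=> P [_ /(_ _ Sx)].
apply: contrapT => /sepS[e [f [[P hP fE] fx fS]]].
move/eqP: fx; apply; rewrite fE; apply: Sx; split; first by exists e.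
by move=> v /fS; rewrite fE.
Qed.

End Separation.

Section Monomials.
Variables (m N : nat).

Definition monom_set : {pred 'X_{1..m < N.+1}} := [pred x | mdeg (val x) == N].

Definition monom (i : 'I_#|monom_set|) : 'X_{1..m} := val (enum_val i).

Lemma mdeg_monom i : mdeg (monom i) = N.
Proof. by apply/eqP; have := enum_valP i. Qed.

Lemma monom_inj : injective monom.
Proof. by move=> i j /val_inj /enum_val_inj. Qed.

Lemma monom_surj (x : 'X_{1..m}) : mdeg x = N -> exists i, monom i = x.
Proof.
move=> dx; have lt_x : (mdeg x < N.+1)%N by rewrite dx.
have xin : BMultinom lt_x \in monom_set by rewrite inE /= dx.
by exists (enum_rank_in xin (BMultinom lt_x)); rewrite /monom enum_rankK_in.
Qed.

Lemma homog_monomE (R : comNzRingType) (p : {mpoly R[m]}) : p \is N.-homog ->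
  p = \sum_i p@_(monom i) *: 'X_[monom i].
Proof.
move=> hp; apply/mpolyP => x; rewrite raddf_sum /=.
have [dx|ndx] := eqVneq (mdeg x) N; last first.
  rewrite (dhomog_nemf_coeff hp) // big1 // => i _.
  rewrite mcoeffZ mcoeffX; case: eqP => [ix|_]; last by rewrite mulr0.
  by rewrite -ix mdeg_monom eqxx in ndx.
have [i <-] := monom_surj dx; rewrite (bigD1 i) //= mcoeffZ mcoeffX eqxx mulr1.
rewrite big1 ?addr0 // => j ne_ji; rewrite mcoeffZ mcoeffX.
by rewrite (inj_eq monom_inj) (negPf ne_ji) mulr0.
Qed.

End Monomials.

Section Elimination.
Variables (K : closedFieldType) (V : vectType K) (m : nat) (T : finType).
Variables (Q : T -> V -> {mpoly K[m.+1]}) (e : T -> nat) (E : nat).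
Hypothesis homQ : forall t v, Q t v \is (e t).-homog.
Hypothesis polyQ : forall t, polymap (@mpolyC m.+1 K) E (Q t).

Definition has_zero (v : V) : Prop :=
  exists z : 'I_m.+1 -> K, (exists i, z i != 0) /\ forall t, (Q t v).@[z] = 0.

Definition gen_ideal (v : V) (p : {mpoly K[m.+1]}) : Prop :=
  exists u : T -> {mpoly K[m.+1]}, p = \sum_t Q t v * u t.

Lemma pihomog_gen v N u : pihomog mdeg N (\sum_t Q t v * u t) =
  \sum_t Q t v * (if (e t <= N)%N then pihomog mdeg (N - e t) (u t) else 0).
Proof.
rewrite raddf_sum /=; apply: eq_bigr => t _; rewrite (pihomogM _ _ (homQ t v)).
by case: ifP; rewrite ?mulr0.
Qed.

Lemma gen_ideal_graded v : graded_ideal (gen_ideal v).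
Proof.
split=> [|p q [u ->] [w ->]|p q [u ->]|N p [u ->]].
- by exists (fun=> 0); rewrite big1 // => t _; rewrite mulr0.
- by exists (fun t => u t + w t); rewrite -big_split; apply: eq_bigr => t _; rewrite mulrDr.
- by exists (fun t => p * u t); rewrite mulr_sumr; apply: eq_bigr => t _; rewrite mulrCA.
by eexists; apply: pihomog_gen.
Qed.

Lemma no_zero_contains v : ~ has_zero v -> exists N, contains_degree (gen_ideal v) N.
Proof.
move=> nz; apply: improper_exists => /(graded_nullstellensatz (gen_ideal_graded v)).
move=> [z [z0 zI]]; apply: nz; exists z; split=> // t.
apply: zI (homQ t v) _; exists (fun s => (s == t)%:R).
by rewrite (bigD1 t) //= eqxx mulr1 big1 ?addr0 // => s /negPf->; rewrite mulr0.
Qed.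

(* Some N has all X^m with |m| = N of the form sum_t u_(m,t) Q_t(v0); the matrix of
   coefficients of the sum_t u_(m,t) Q_t(v) is the identity at v0 and is singular
   wherever the Q_t(v) have a common zero. *)
Theorem elimination : separated has_zero.
Proof.
move=> v0 /no_zero_contains[N cN].
pose mon := @monom m.+1 N.
have /boolp.choice[u uE] : forall i, exists u : T -> {mpoly K[m.+1]},
    (forall v, \sum_t Q t v * u t \is N.-homog) /\ 'X_[mon i] = \sum_t Q t v0 * u t.
  move=> i; have hX : 'X_[mon i] \is [in K[m.+1], N.-homog].
    by rewrite dhomogX; apply/eqP/mdeg_monom.
  have [w wE] := cN _ hX.
  (* Truncating the multipliers to the right degree keeps the combination homogeneous of degree N at
     every [v], not only at [v0]; its coefficients then fill a square matrix. *)
  exists (fun t => if (e t <= N)%N then pihomog mdeg (N - e t) (w t) else 0).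
  split=> [v|]; first by rewrite -pihomog_gen; apply: pihomogP.
  by rewrite -pihomog_gen -wE pihomog_dE.
pose G v := \matrix_(i, j) (\sum_t Q t v * u i t)@_(mon j).
exists (#|@monom_set m.+1 N| * E)%N, (fun v => \det (G v)); split.
- apply: polymap_det => i j.
  apply: (@polymap_ext _ _ _ _ _ (mcoeff (mon j) \o (fun v => \sum_t Q t v * u i t))).
    by move=> v; rewrite mxE.
  apply: (polymap_map (io := @mpolyC m.+1 K)).
    by move=> c b; rewrite /= mul_mpolyC; apply: mcoeffZ.
  apply: polymap_sum => t; apply: polymap_ext (polymapZ (u i t) (polyQ t)) => v.
  by rewrite mulrC.
- rewrite (_ : G v0 = 1%:M) ?det1 ?oner_neq0 //.
  apply/matrixP => i j; rewrite !mxE -(uE i).2 mcoeffX (inj_eq (@monom_inj _ _)).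
  by [].
move=> v [z [[i0 zi0] zQ]]; rewrite -det_tr; apply/eqP/det0P.
exists (\row_j 'X_[mon j].@[z]).
  (* The values at [z] of the monomials of degree N form a nonzero vector: the N-th power of a
     nonvanishing coordinate is among them. *)
  have [j jE] : exists j, mon j = (U_(i0) *+ N)%MM.
    by apply: monom_surj; rewrite mdegMn mdeg1 mul1n.
  apply/eqP => /rowP/(_ j)/eqP; rewrite !mxE jE -mpolyXn rmorphXn /= mevalXU.
  by rewrite expf_eq0 (negPf zi0) andbF.
apply/rowP => i; rewrite !mxE.
transitivity ((\sum_t Q t v * u i t).@[z]).
  rewrite [in RHS](homog_monomE ((uE i).1 v)) raddf_sum /=.
  by apply: eq_bigr => j _; rewrite !mxE mevalZ mulrC.
by rewrite raddf_sum big1 // => t _; rewrite /= mevalM zQ mul0r.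
Qed.

End Elimination.

Lemma finType_ordinal (T : finType) (t0 : T) :
  exists m (idx : T -> 'I_m.+1) (inv : 'I_m.+1 -> T), cancel idx inv /\ cancel inv idx.
Proof.
have cT : #|T| = #|T|.-1.+1 by rewrite prednK //; apply/card_gt0P; exists t0.
exists #|T|.-1, (cast_ord cT \o enum_rank), (enum_val \o cast_ord (esym cT)).
by split=> i /=; rewrite ?cast_ordK ?cast_ordKV ?enum_rankK ?enum_valK ?cast_ordKV.
Qed.

Lemma monom_exists m N : exists i : 'I_#|@monom_set m.+1 N|, monom i = (U_(ord0) *+ N)%MM.
Proof. by apply: monom_surj; rewrite mdegMn mdeg1 mul1n. Qed.

Section Products.
Variables (K : closedFieldType) (V : vectType K) (n : nat) (E k1 k2 k3 : nat).
Variables (w : {mpoly K[n.+1]}) (ct : V -> {mpoly K[n.+1]}).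
Hypotheses (w0 : w != 0) (homw : w \is k3.-homog).
Hypothesis homct : forall v, ct v \is (k3 + (k1 + k2))%N.-homog.
Hypothesis polyct : polymap (@mpolyC n.+1 K) E ct.

(** Only [g] must be nonzero: with h = 0 the tuples where [ct v] vanishes belong to the set. *)
Definition factors (v : V) : Prop := exists g h : {mpoly K[n.+1]},
  [/\ g != 0, g \is k1.-homog, h \is k2.-homog & ct v = w * (g * h)].

Local Notation I1 := 'I_#|@monom_set n.+1 k1|.
Local Notation I2 := 'I_#|@monom_set n.+1 k2|.
Local Notation I3 := 'I_#|@monom_set n.+1 (k3 + (k1 + k2))|.

Let tprod (z : I1 * I2 -> K) : {mpoly K[n.+1]} :=
  w * \sum_t z t *: ('X_[monom t.1] * 'X_[monom t.2]).

Let tprod_homog z : tprod z \is (k3 + (k1 + k2))%N.-homog.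
Proof.
apply: dhomogM => //; apply: rpred_sum => t _; apply: rpredZ.
by apply: dhomogM; rewrite dhomogX; apply/eqP/mdeg_monom.
Qed.

Let tprodE (g h : {mpoly K[n.+1]}) : g \is k1.-homog -> h \is k2.-homog ->
  tprod (fun t => g@_(monom t.1) * h@_(monom t.2)) = w * (g * h).
Proof.
move=> hg hh; rewrite /tprod; congr (_ * _).
rewrite [in RHS](homog_monomE hg) [in RHS](homog_monomE hh) mulr_suml.
under [RHS]eq_bigr do rewrite mulr_sumr.
rewrite pair_bigA /=; apply: eq_bigr => t _.
by rewrite -scalerAl -scalerAr scalerA.
Qed.

(* Over a nonzero value of ct, a rank one tensor t = g (x) h is sought whose product form is
   proportional to ct; both conditions are quadratic or linear in t, and t ranges over a
   projective space. *)
Lemma factors_separated : separated factors.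
Proof.
have [i1 i1E] := monom_exists n k1; have [i2 i2E] := monom_exists n k2.
have [m [idx [inv [idxK invK]]]] := @finType_ordinal _ (i1, i2).
pose T : finType := ((I1 * I2 * (I1 * I2) * I3) + I3 * I3)%type.
pose L (c : I3) : {mpoly K[m.+1]} :=
  \sum_(t : I1 * I2) (w * ('X_[monom t.1] * 'X_[monom t.2]))@_(monom c) *: 'X_(idx t).
(* The first family is the 2 x 2 minors of the tensor, the second the proportionality to [ct v]. The
   factor from [ct v] before the minors gives every equation degree E in [v] and makes all of them
   vacuous when [ct v = 0], in accordance with h = 0 in [factors]. *)
pose Q (x : T) (v : V) : {mpoly K[m.+1]} := match x with
  | inl (t, s, c) => (ct v)@_(monom c) *:
      ('X_(idx t) * 'X_(idx s) - 'X_(idx (t.1, s.2)) * 'X_(idx (s.1, t.2)))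
  | inr (b, c) => (ct v)@_(monom b) *: L c - (ct v)@_(monom c) *: L b
  end.
have LE c z : (L c).@[z] = (tprod (z \o idx))@_(monom c).
  rewrite /L /tprod raddf_sum mulr_sumr raddf_sum /=; apply: eq_bigr => t _.
  by rewrite mevalZ mevalXU -scalerAr mcoeffZ mulrC.
have evalB z x y (p q : {mpoly K[m.+1]}) :
    (x *: p - y *: q).@[z] = x * p.@[z] - y * q.@[z] by rewrite mevalB !mevalZ.
pose e (x : T) := if x is inl _ then 2%N else 1%N.
have hX i : 'X_i \is [in K[m.+1], 1.-homog] by exact: mpolyX_homog.
have homQ x v : Q x v \is (e x).-homog.
  have hL c : L c \is 1.-homog by apply: rpred_sum => t _; apply: rpredZ.
  case: x => [[[t s] c]|[b c]] /=; last by apply: rpredB; apply: rpredZ.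
  by apply: rpredZ; apply: rpredB; apply: (@dhomogM _ _ _ 1 _ 1).
have polyQ x : polymap (@mpolyC m.+1 K) E (Q x).
  have coefP c : polymap idfun E (fun v => (ct v)@_(monom c)) by apply: polymap_mcoeff.
  case: x => [[[t s] c]|[b c]]; first exact: polymap_scale.
  by apply: polymapD; last apply: polymapN; apply: polymap_scale.
have factorsE v : factors v <-> has_zero Q v.
  split=> [[g [h [g0 hg hh ctE]]]|[z [[c0 zc0] zQ]]].
    have [ct0|ct0] := eqVneq (ct v) 0.
      exists (fun=> 1); split; first by exists ord0; apply: oner_neq0.
      by case=> [[[t s] c]|[b c]] /=; rewrite ct0 !mcoeff0 !scale0r ?subr0 meval0.
    pose z (t : I1 * I2) := g@_(monom t.1) * h@_(monom t.2).
    have zE : z \o inv \o idx = z by apply/funext => t /=; rewrite idxK.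
    have LzE c : (L c).@[z \o inv] = (ct v)@_(monom c) by rewrite LE zE tprodE // ctE.
    exists (z \o inv); split.
      have [c c0] : exists c : I3, (ct v)@_(monom c) != 0.
        apply/existsP; apply: contraNT ct0; rewrite negb_exists => /forallP z0.
        rewrite (homog_monomE (homct v)) big1 // => c _.
        by have := z0 c; rewrite negbK => /eqP->; rewrite scale0r.
      apply/existsP; apply: contraNT c0; rewrite negb_exists => /forallP z0.
      rewrite -LzE /L raddf_sum big1 // => t _.
      by rewrite /= mevalZ mevalXU; have := z0 (idx t); rewrite negbK => /eqP->; rewrite mulr0.
    case=> [[[t s] c]|[b c]] /=.
      rewrite mevalZ mevalB !mevalM !mevalXU /= !idxK /z /= [X in _ - X]mulrACA.
      by rewrite [h@_(monom s.2) * _]mulrC -mulrACA subrr mulr0.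
    by rewrite evalB (LzE b) (LzE c) [X in X - _]mulrC subrr.
  have [ct0|ct0] := eqVneq (ct v) 0.
    exists 'X_[monom i1], 0; split=> //.
    - by rewrite -msize_poly_eq0 msizeX.
    - by rewrite dhomogX; apply/eqP/mdeg_monom.
    - exact: dhomog0.
    - by rewrite ct0 !mulr0.
  have [c1 ctc1] : exists c : I3, (ct v)@_(monom c) != 0.
    apply/existsP; apply: contraNT ct0; rewrite negb_exists => /forallP z0.
    rewrite (homog_monomE (homct v)) big1 // => c _.
    by have := z0 c; rewrite negbK => /eqP->; rewrite scale0r.
  have rank1 t s : z (idx t) * z (idx s) = z (idx (t.1, s.2)) * z (idx (s.1, t.2)).
    have /eqP := zQ (inl (t, s, c1)); rewrite /= mevalZ mevalB !mevalM !mevalXU.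
    by rewrite mulf_eq0 (negPf ctc1) subr_eq0 => /eqP.
  (* A rank one tensor is recovered, up to its nonzero entry at [t0], from the row and the column
     through that entry. *)
  pose t0 := inv c0; have zt0 : z (idx t0) != 0 by rewrite invK.
  pose g : {mpoly K[n.+1]} := \sum_(i : I1) z (idx (i, t0.2)) *: 'X_[monom i].
  pose h : {mpoly K[n.+1]} := \sum_(j : I2) z (idx (t0.1, j)) *: 'X_[monom j].
  have coef_g i : g@_(monom i) = z (idx (i, t0.2)).
    rewrite raddf_sum (bigD1 i) //= mcoeffZ mcoeffX eqxx mulr1 big1 ?addr0 // => j ne_ji.
    by rewrite mcoeffZ mcoeffX (inj_eq (@monom_inj _ _)) (negPf ne_ji) mulr0.
  have coef_h i : h@_(monom i) = z (idx (t0.1, i)).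
    rewrite raddf_sum (bigD1 i) //= mcoeffZ mcoeffX eqxx mulr1 big1 ?addr0 // => j ne_ji.
    by rewrite mcoeffZ mcoeffX (inj_eq (@monom_inj _ _)) (negPf ne_ji) mulr0.
  have hg : g \is k1.-homog.
    by apply: rpred_sum => i _; apply: rpredZ; rewrite dhomogX; apply/eqP/mdeg_monom.
  have hh : h \is k2.-homog.
    by apply: rpred_sum => i _; apply: rpredZ; rewrite dhomogX; apply/eqP/mdeg_monom.
  have g0 : g != 0.
    by apply: contraNneq zt0 => g0; rewrite [t0]surjective_pairing -coef_g g0 mcoeff0.
  have h0 : h != 0.
    by apply: contraNneq zt0 => h0; rewrite [t0]surjective_pairing -coef_h h0 mcoeff0.
  have ghE : w * (g * h) = z (idx t0) *: tprod (z \o idx).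
    rewrite -tprodE // /tprod scalerAr; congr (_ * _); rewrite scaler_sumr.
    apply: eq_bigr => t _; rewrite coef_g coef_h scalerA; congr (_ *: _).
    by rewrite (rank1 (t.1, t0.2) (t0.1, t.2)) /= mulrC -!surjective_pairing.
  (* As polynomials form a domain, a nonzero rank one tensor has a nonzero product form, so
     proportionality makes [ct v] a multiple of it. *)
  have [b tb] : exists b : I3, (tprod (z \o idx))@_(monom b) != 0.
    have wgh0 : w * (g * h) != 0 by rewrite !mulf_neq0.
    apply/existsP; apply: contraNT wgh0; rewrite negb_exists => /forallP z0.
    rewrite ghE (homog_monomE (tprod_homog _)) big1 ?scaler0 // => c _.
    by have := z0 c; rewrite negbK => /eqP->; rewrite scale0r.
  pose lam := (ct v)@_(monom b) / (tprod (z \o idx))@_(monom b).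
  exists g, ((lam / z (idx t0)) *: h); split=> //; first exact: rpredZ.
  rewrite -!scalerAr ghE scalerA divfK //.
  rewrite [LHS](homog_monomE (homct v)) [in RHS](homog_monomE (tprod_homog _)) scaler_sumr.
  apply: eq_bigr => c _; rewrite scalerA; congr (_ *: _).
  have /eqP := zQ (inr (b, c)); rewrite /= evalB (LE c) (LE b) subr_eq0 => /eqP E'.
  by rewrite /lam mulrAC E' mulfK.
move=> v0 nf; have [|e' [f [pf f0 fS]]] := elimination homQ polyQ (v0 := v0).
  by rewrite -factorsE.
by exists e', f; split=> // v /factorsE /fS.
Qed.

End Products.

(** * The critical form *)

Section HomogeneousDerivatives.
Variables (K : fieldType) (n : nat).
Implicit Types (p : {mpoly K[n]}).

Lemma homog_deriv d k p : p \is d.-homog -> p^`M(k) \is d.-1.-homog.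
Proof.
move=> hp; apply/dhomogP => m; rewrite mcoeff_msupp mcoeff_deriv => nz.
have : (m + U_(k))%MM \in msupp p.
  by rewrite mcoeff_msupp; apply: contraNneq nz => ->; rewrite mul0rn.
by move=> /(dhomog_mf hp) /= <-; rewrite mdegD mdeg1 addn1.
Qed.

Lemma euler_homog d p : p \is d.-homog -> \sum_k 'X_k * p^`M(k) = p *+ d.
Proof.
move=> hp; rewrite {2}[p]mpolyE -sumrMnl.
under eq_bigr do rewrite {1}[p]mpolyE raddf_sum mulr_sumr /=.
rewrite exchange_big /= big_seq [RHS]big_seq; apply: eq_bigr => m /(dhomog_mf hp) /= dm.
rewrite -dm mdegE -sumrMnr; apply: eq_bigr => k _.
rewrite mderivZ mderivX -!scalerAr scaler_nat scalerMnr; congr (_ *: _).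
have [->|mk0] := eqVneq (m k) 0%N; first by rewrite !mulr0n.
by rewrite -mpolyXD addmC submK // lep1mP.
Qed.

Lemma homog_prod_deg (T : Type) (r : seq T) (F : T -> {mpoly K[n]}) (e : T -> nat) :
  (forall t, F t \is (e t).-homog) ->
  \prod_(t <- r) F t \is (\sum_(t <- r) e t)%N.-homog.
Proof.
move=> hF; elim: r => [|t r IHr]; first by rewrite !big_nil dhomog1.
by rewrite !big_cons; apply: dhomogM.
Qed.

Lemma homog_det k (A : 'M[{mpoly K[n]}]_k) (e : 'I_k -> nat) :
  (forall i j, A i j \is (e j).-homog) -> \det A \is (\sum_j e j)%N.-homog.
Proof.
move=> hA; apply: rpred_sum => s _; rewrite -signr_odd.
have hP : \prod_i A i (s i) \is (\sum_j e j)%N.-homog.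
  have -> : (\sum_j e j = \sum_i e (s i))%N by rewrite (reindex_inj (@perm_inj _ s)).
  by apply: homog_prod_deg => i; apply: hA.
by case: odd_perm; rewrite ?expr0 ?expr1 ?mul1r ?mulN1r ?dhomogN.
Qed.

End HomogeneousDerivatives.

Section CriticalForm.
Variables (K : fieldType) (n d : nat) (F : 'I_n.+1 -> {mpoly K[n.+1]}).
Hypothesis homF : forall l, F l \is d.-homog.

Definition jac_mx (i : 'I_n.+1) : 'M[{mpoly K[n.+1]}]_n.+1 :=
  \matrix_(l, k) (if k == i then F l else (F l)^`M(k)).

Lemma det_jac_mx_homog i : \det (jac_mx i) \is (d + n * d.-1)%N.-homog.
Proof.
have -> : (d + n * d.-1 = \sum_(k < n.+1) (if k == i then d else d.-1))%N.
  rewrite (bigD1 i) //= eqxx (eq_bigr (fun=> d.-1)).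
    by rewrite sum_nat_const cardC1 card_ord.
  by move=> k /negPf->.
apply: homog_det => l k; rewrite mxE; case: ifP => _ //.
exact: homog_deriv.
Qed.

(* By Euler's relation, x_j times column j of [jac_mx i] is, up to combining the other
   columns, -x_i times the derivative by x_i. *)
Lemma det_jac_mx_swap i j : 'X_j * \det (jac_mx i) = 'X_i * \det (jac_mx j).
Proof.
have [->//|ne_ij] := eqVneq i j.
(* A column operation: column j becomes -d F plus the sum over a other than i of X_a times the
   derivative by X_a, which is -X_i times the derivative by X_i. Nothing is divided by d. *)
pose E : 'M[{mpoly K[n.+1]}]_n.+1 := \matrix_(a, b)
  (if b == j then (if a == i then - d%:R else 'X_a) else (a == b)%:R).
have detE : \det E = 'X_j.
  rewrite (expand_det_row E j) (bigD1 j) //= big1 ?addr0 => [|b ne_bj].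
    rewrite mxE eqxx eq_sym (negPf ne_ij) /cofactor addnn -signr_odd odd_double expr0 mul1r.
    rewrite (_ : row' j (col' j E) = 1%:M) ?det1 ?mulr1 //.
    apply/matrixP => a b; rewrite !mxE eq_sym (negPf (neq_lift _ _)).
    by rewrite (inj_eq lift_inj).
  by rewrite mxE (negPf ne_bj) eq_sym (negPf ne_bj) mul0r.
pose D : 'rV[{mpoly K[n.+1]}]_n.+1 := \row_b (if b == j then - 'X_i else 1).
have JE : jac_mx i *m E = xcol i j (jac_mx j) *m diag_mx D.
  apply/matrixP => l b; rewrite mul_mx_diag !mxE.
  have [->|ne_bj] := eqVneq b j; last first.
    rewrite (bigD1 b) //= !mxE (negPf ne_bj) eqxx mulr1 big1 => [|a ne_ab].
      rewrite addr0 mulr1; have [->|ne_bi] := eqVneq b i; first by rewrite tpermL eqxx.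
      by rewrite (_ : tperm i j b = b) ?(negPf ne_bj) // tpermD // eq_sym.
    by rewrite !mxE (negPf ne_bj) (negPf ne_ab) mulr0.
  rewrite tpermR (negPf ne_ij).
  have /eqP := euler_homog (homF l); rewrite (bigD1 i) //= => /eqP eul.
  rewrite (bigD1 i) //= !mxE !eqxx mulrN mulr_natr -eul opprD mulrN mulrC.
  rewrite -[RHS]addr0 -addrA; congr (_ + _); apply/eqP; rewrite addrC subr_eq0; apply/eqP.
  by apply: eq_bigr => a ne_ai; rewrite !mxE eqxx (negPf ne_ai) mulrC.
have detD : \det (diag_mx D) = - 'X_i.
  rewrite det_diag (bigD1 j) //= mxE eqxx big1 ?mulr1 // => b ne_bj.
  by rewrite mxE (negPf ne_bj).
have := congr1 determinant JE.
rewrite det_mulmx detE det_mulmx detD xcolE det_mulmx det_perm odd_tperm ne_ij expr1.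
by move=> E'; rewrite mulrC E' [_ * -1]mulrN1 mulrNN; apply: mulrC.
Qed.

(** By [det_jac_mx_swap], X_0 divides X_1 times the determinant for column 0. It is prime and does
    not divide X_1, as evaluation at a point with x_0 = 0 and x_1 = 1 shows. *)
Lemma critical_form_exists : (0 < n)%N -> (0 < d)%N ->
  exists2 c : {mpoly K[n.+1]}, c \is (n.+1 * d.-1)%N.-homog &
    forall i, \det (jac_mx i) = 'X_i * c.
Proof.
move=> n0 d0; pose i1 : 'I_n.+1 := Ordinal (n0 : (1 < n.+1)%N).
have X0 i : 'X_i != 0 :> {mpoly K[n.+1]} by case: (mpolyX_irreducible K i).
have : divides 'X_ord0 ('X_i1 * \det (jac_mx ord0)).
  by rewrite -det_jac_mx_swap; apply/divides_mulr/divides_refl.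
case/(mpoly_irreducible_prime (mpolyX_irreducible K _)).
  move=> [q /(congr1 (fun p => p.@[fun i => (i != ord0)%:R]))].
  by rewrite mevalM !mevalXU eqxx mul0r => /eqP; rewrite oner_eq0.
move=> [c cE]; exists c.
  have := det_jac_mx_homog ord0; rewrite cE; have [->|c0] := eqVneq c 0.
    by rewrite dhomog0.
  move=> hXc; have Xc0 : 'X_ord0 * c != 0 by rewrite mulf_neq0.
  have [a [b [abE hX hc]]] := homog_factor Xc0 hXc.
  have a1 : a = 1%N.
    by apply: dhomog_uniq (X0 ord0) hX _; rewrite dhomogX /= mdeg1.
  rewrite (_ : (n.+1 * d.-1)%N = b) //; apply/eqP.
  by rewrite -(eqn_add2l 1) -{2}a1 abE mulSn addnA add1n prednK.
by move=> i; apply: (mulfI (X0 ord0)); rewrite det_jac_mx_swap cE mulrCA.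
Qed.

End CriticalForm.

(** Used with k + 1 = n, x = X_i, y = F_j: the scalar in front of the n x n matrix of quotient rule
    numerators, raised to the power n, times the determinant of that matrix. *)
Lemma field_power_identity (F : fieldType) (k : nat) (x z y : F) : y != 0 ->
  (x / y ^+ 2) ^+ k.+1 * (y ^+ k * (x * z)) = x ^+ k.+2 * z / y ^+ k.+2.
Proof.
move=> y0; have yk0 i : y ^+ i != 0 by rewrite expf_neq0.
apply: (mulIf (yk0 k.+2)); rewrite divfK // exprMn exprVn -exprM.
have -> (a b p q : F) : a * b * (p * (x * z)) * q = x * a * z * (b * (p * q))
  by rewrite [LHS](AC ((2*(1*2))*1) ((4*1*5)*(2*(3*6)))).
rewrite -exprS -exprD (_ : (k + k.+2 = 2 * k.+1)%N) ?mulVf ?mulr1 //.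
by rewrite mul2n -addnn addnS.
Qed.

Lemma det_diff_mx (K : fieldType) (n d : nat) (f : EndBar K n d) (i j : 'I_n.+1)
    (c : {mpoly K[n.+1]}) :
  (0 < n)%N -> forms f j != 0 -> \det (jac_mx (forms f) i) = 'X_i * c ->
  \det (diff_mx f i j) =
  (-1) ^+ (j + i) * (tofrac ('X_i ^+ n.+1 * c) / tofrac (forms f j ^+ n.+1)).
Proof.
move=> n0 Fj0 cE; set F := forms f in Fj0 cE *.
(* Row operations replacing row a by F_j (row a) - F_a (row j). They clear column i outside row j
   and leave as minor the matrix [N] of quotient rule numerators. *)
pose T : 'M[{mpoly K[n.+1]}]_n.+1 := \matrix_(a, b)
  (if a == j then (a == b)%:R else if b == j then - F a else F j *+ (a == b)).
have detT : \det T = F j ^+ n.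
  rewrite (expand_det_row T j) (bigD1 j) //= big1 ?addr0 => [|b ne_bj].
    rewrite mxE !eqxx /cofactor addnn -signr_odd odd_double expr0 !mul1r.
    rewrite (_ : row' j (col' j T) = (F j)%:M) ?det_scalar //.
    apply/matrixP => a b; rewrite !mxE ![lift j _ == j]eq_sym !(negPf (neq_lift _ _)).
    by rewrite (inj_eq lift_inj).
  by rewrite mxE eqxx eq_sym (negPf ne_bj) mul0r.
pose N : 'M[{mpoly K[n.+1]}]_n := \matrix_(l, k)
  ((F (lift j l))^`M(lift i k) * F j - F (lift j l) * (F j)^`M(lift i k)).
have TJ a b : (T *m jac_mx F i) a b =
    if a == j then jac_mx F i j b else F j * jac_mx F i a b - F a * jac_mx F i j b.
  rewrite !mxE; have [->|ne_aj] := eqVneq a j.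
    rewrite (bigD1 j) //= !mxE !eqxx mul1r big1 ?addr0 // => e ne_ej.
    by rewrite !mxE eqxx eq_sym (negPf ne_ej) mul0r.
  rewrite (bigD1 j) //= (bigD1 a) //= !mxE (negPf ne_aj) !eqxx big1 => [|e /andP[ne_ej ne_ea]].
    by rewrite addr0 addrC mulNr mulr1n.
  by rewrite !mxE (negPf ne_aj) (negPf ne_ej) eq_sym (negPf ne_ea) mulr0n mul0r.
have detN : F j ^+ n * \det (jac_mx F i) = F j * ((-1) ^+ (j + i) * \det N).
  rewrite -detT -det_mulmx (expand_det_col _ i) (bigD1 j) //= big1 ?addr0 => [|a ne_aj].
    rewrite TJ eqxx mxE eqxx; congr (_ * (_ * \det _)).
    apply/matrixP => l k; rewrite 2![LHS]mxE TJ eq_sym (negPf (neq_lift _ _)).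
    by rewrite !mxE eq_sym (negPf (neq_lift _ _)) mulrC.
  by rewrite TJ (negPf ne_aj) !mxE eqxx [F a * _]mulrC subrr mul0r.
have detN' : \det N = (-1) ^+ (j + i) * (F j ^+ n.-1 * ('X_i * c)).
  apply: (mulfI Fj0); rewrite [RHS]mulrCA [F j * (F j ^+ _ * _)]mulrA -exprS prednK //.
  rewrite -cE detN [RHS]mulrCA; congr (_ * _).
  by rewrite mulrA -expr2 sqrr_sign mul1r.
have -> : diff_mx f i j =
    (tofrac 'X_i / tofrac (F j ^+ 2)) *: map_mx (@tofrac {mpoly K[n.+1]}) N.
  apply/matrixP => l k; rewrite !mxE /chart_deriv -/F.
  by rewrite mulrAC mulrA.
rewrite detZ det_map_mx detN' !rmorphM /= !rmorphXn /= rmorphN1 [LHS]mulrCA.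
congr (_ * _); have := field_power_identity n.-1 (tofrac 'X_i) (tofrac c).
by move=> /(_ (tofrac (F j))); rewrite (prednK n0) => -> //; rewrite tofrac_eq0.
Qed.

(** * Points of projective space *)

Section Points.
Variables (K : fieldType) (n : nat).
Implicit Types (p : Proj K n) (G H : {mpoly K[n.+1]}).

Lemma pt0 p : 0 \in (p : {pred _}).
Proof. by case: (pt_idealr p). Qed.

Lemma pt1 p : 1 \notin (p : {pred _}).
Proof. by case: (pt_idealr p). Qed.

Lemma ptD p G H : G \in (p : {pred _}) -> H \in (p : {pred _}) -> G + H \in (p : {pred _}).
Proof. by case: (pt_idealr p) => _ _ cl hG hH; rewrite -[G]mul1r; apply: cl. Qed.

Lemma ptM p G H : H \in (p : {pred _}) -> G * H \in (p : {pred _}).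
Proof.
by case: (pt_idealr p) => p0 _ cl hH; rewrite -[G * H]addr0; apply: cl.
Qed.

Lemma ptMN p G H : G \notin (p : {pred _}) -> H \notin (p : {pred _}) ->
  G * H \notin (p : {pred _}).
Proof. by move=> nG nH; apply/negP => /pt_prime /orP[]; apply/negP. Qed.

Lemma ptXN p G k : G \notin (p : {pred _}) -> G ^+ k \notin (p : {pred _}).
Proof. by move=> nG; elim: k => [|k IHk]; [apply: pt1|rewrite exprS; apply: ptMN]. Qed.

Lemma pt_neq0 p G : G \notin (p : {pred _}) -> G != 0.
Proof. by apply: contraNneq => ->; apply: pt0. Qed.

Lemma pt_divides p G H : divides G H -> G \in (p : {pred _}) -> H \in (p : {pred _}).
Proof. by case=> q -> pG; rewrite mulrC; apply: ptM. Qed.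

Lemma zero_point_exists : exists p, forall G, (G \in (p : {pred _})) = (G == 0).
Proof.
have id0 : idealr_closed (pred1 (0 : {mpoly K[n.+1]})).
  split; rewrite ?inE ?oner_neq0 ?eqxx // => a u v; rewrite !inE => /eqP-> /eqP->.
  by rewrite mulr0 addr0.
have pr0 : prime_idealr_closed (pred1 (0 : {mpoly K[n.+1]})).
  by move=> u v; rewrite !inE mulf_eq0.
have ho0 e G : G \in pred1 (0 : {mpoly K[n.+1]}) -> pihomog mdeg e G \in pred1 0.
  by rewrite !inE => /eqP->; rewrite raddf0.
have re0 : exists i : 'I_n.+1, 'X_i \notin pred1 (0 : {mpoly K[n.+1]}).
  by exists ord0; rewrite inE; case: (mpolyX_irreducible K (@ord0 n)).
by exists (ProjPoint id0 pr0 ho0 re0).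
Qed.

(** The generic point of w = 0. The ideal (w) is relevant since otherwise [w] would be associated to
    both X_0 and X_1. *)
Lemma irreducible_point_exists (w : {mpoly K[n.+1]}) e : (0 < n)%N -> irreducible_elt w ->
  w \is e.-homog -> exists p, forall G, G \in (p : {pred _}) <-> divides w G.
Proof.
move=> n0 irrw hw; pose I : {pred {mpoly K[n.+1]}} := fun G => `[< divides w G >].
have IP G : G \in I <-> divides w G by split=> /asboolP.
have [w0 wU _] := irrw.
have idI : idealr_closed I.
  split; first by apply/IP; exists 0; rewrite mulr0.
    apply/negP => /IP[q E]; move/negP: wU; apply; apply/unitrP; exists q.
    by rewrite mulrC -E.
  by move=> a u v /IP[q ->] /IP[r ->]; apply/IP; exists (a * q + r); rewrite mulrDr mulrCA.
have prI : prime_idealr_closed I.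
  by move=> u v /IP/(mpoly_irreducible_prime irrw)[] /IP->; rewrite ?orbT.
have hoI e' G : G \in I -> pihomog mdeg e' G \in I.
  move=> /IP[q ->]; apply/IP; rewrite (pihomogM _ _ hw).
  by case: ifP => _; [apply/divides_mulr/divides_refl|exists 0; rewrite mulr0].
have reI : exists i : 'I_n.+1, 'X_i \notin I.
  apply: contrapT => /forallNP nX; pose i1 : 'I_n.+1 := Ordinal (n0 : (1 < n.+1)%N).
  have wX i : divides w 'X_i by apply/IP/negPn/negP/nX.
  have X0w := irreducible_divides irrw (mpolyX_irreducible K ord0) (wX ord0).
  have [q E] := divides_trans X0w (wX i1).
  have := congr1 (fun q : {mpoly K[n.+1]} => q.@[fun i => (i != ord0)%:R]) E.
  by rewrite mevalM !mevalXU eqxx mul0r => /eqP; rewrite oner_eq0.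
by exists (ProjPoint idI prI hoI reI).
Qed.

Definition vanishing (G : {mpoly K[n.+1]}) : set (Proj K n) :=
  [set p : Proj K n | G \in (p : {pred _})].

Lemma vanishing_closed e G : G \is e.-homog -> Proj_closed (vanishing G).
Proof.
move=> hG; exists [set G]; first by move=> _ ->; exists e.
apply/seteqP; split=> p /= pG; last exact: pG.
by move=> _ ->.

Qed.

Lemma setT_closed : @Proj_closed K n setT.
Proof. by exists set0 => [G []|]; apply/seteqP; split=> p //= _ G []. Qed.

Lemma closed_at_generic (G : {mpoly K[n.+1]}) (eta : Proj K n) (A : set (Proj K n)) :
  (forall H, H \in (eta : {pred _}) <-> divides G H) -> Proj_closed A -> A eta ->
  vanishing G `<=` A.
Proof.
move=> etaP [T _ ->] Teta p pG H TH.
by apply: pt_divides pG; apply/etaP; apply: Teta.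
Qed.

Lemma vanishing_irreducible e (w : {mpoly K[n.+1]}) :
  (0 < n)%N -> irreducible_elt w -> w \is e.-homog ->
  irreducible_set (@Proj_closed K n) (vanishing w).
Proof.
move=> n0 irrw hw; have [eta etaP] := irreducible_point_exists n0 irrw hw.
have weta : vanishing w eta by apply/etaP/divides_refl.
split=> [|A B cA cB sub]; first by exists eta.
by have [] := sub _ weta; [left|right]; apply: closed_at_generic etaP _ _.
Qed.

Lemma setT_irreducible : irreducible_set (@Proj_closed K n) setT.
Proof.
have [z zP] := zero_point_exists.
have gen A : Proj_closed A -> A z -> setT `<=` A.
  by move=> [T _ ->] Tz p _ H /Tz; rewrite zP => /eqP->; apply: pt0.
split=> [|A B cA cB sub]; first by exists z.
by have [] := sub z I; [left|right]; apply: gen.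
Qed.

(** A nonzero form vanishing on [W] vanishes at the generic point of w = 0, so it is w H. As [W] is
    irreducible and not inside w = 0, the form H of smaller degree vanishes on [W] too; by descent
    only 0 vanishes on [W]. *)
Lemma closed_above_vanishing e (w : {mpoly K[n.+1]}) (W : set (Proj K n)) : (0 < n)%N ->
  irreducible_elt w -> w \is e.-homog -> Proj_closed W ->
  irreducible_set (@Proj_closed K n) W -> vanishing w `<` W -> W = setT.
Proof.
move=> n0 irrw hw [T homT WE] [_ irrW]; rewrite properEneq => -[ne_W sub_W].
have [eta etaP] := irreducible_point_exists n0 irrw hw.
have Weta : W eta by apply: sub_W; apply/etaP/divides_refl.
have [w0 _ _] := irrw; have e0 := irreducible_homog_gt0 irrw hw.
have nWw : ~ W `<=` vanishing w.
  by move=> subw; move/eqP: ne_W; apply; apply/seteqP.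
have no k G : G != 0 -> G \is k.-homog -> ~ W `<=` vanishing G.
  have [m] := ubnP k; elim: m k G => // m IHm k G /ltnSE le_m G0 hG WG.
  have [H E] := (etaP G).1 (WG _ Weta); rewrite E in G0 hG WG.
  have [le_ek hH] := homog_cofactor G0 hw hG.
  move: (G0); rewrite mulf_eq0 negb_or => /andP[_ H0].
  have [|//|] := irrW _ _ (vanishing_closed hw) (vanishing_closed hH).
    by move=> p /WG /pt_prime /orP[]; [left|right].
  apply: IHm H0 hH; apply: leq_trans le_m; rewrite ltn_subrL e0.
  exact: leq_trans le_ek.
rewrite WE; apply/seteqP; split=> // p _ G TG /=.
have [->|G0] := eqVneq G 0; first exact: pt0.
have [k hG] := homT _ TG; have [] := no k G G0 hG.
by rewrite WE => q /(_ _ TG).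
Qed.

End Points.

(** * The critical scheme *)

Lemma forms_homog (K : fieldType) (n d : nat) (f : EndBar K n d) l :
  forms f l \is d.-homog.
Proof. exact: dhomog_is_dhomog. Qed.

Lemma frac_eq (R : idomainType) (a b x y : R) : b != 0 -> y != 0 ->
  (tofrac a / tofrac b = tofrac x / tofrac y) <-> a * y = x * b.
Proof.
move=> b0 y0; rewrite -tofrac_eq0 in b0; rewrite -tofrac_eq0 in y0.
split=> [/eqP|E].
  by rewrite GRing.eqr_div // -!tofracM tofrac_eq => /eqP.
by apply/eqP; rewrite GRing.eqr_div // -!tofracM E.
Qed.

Lemma frac_mul (R : idomainType) (a b x y : R) :
  tofrac a / tofrac b * (tofrac x / tofrac y) = tofrac (a * x) / tofrac (b * y).
Proof. by rewrite mulf_div !tofracM. Qed.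

Section Stalks.
Variables (K : closedFieldType) (n d : nat) (f : EndBar K n d) (c : {mpoly K[n.+1]}).
Hypotheses (n0 : (0 < n)%N) (d0 : (0 < d)%N) (Endf : @EndSet K n d f).
Local Notation D := (n.+1 * d.-1)%N.
Hypotheses (homc : c \is D.-homog)
  (jacc : forall i, \det (jac_mx (forms f) i) = 'X_i * c).
Implicit Types (p : Proj K n).
Local Notation I := (critical_scheme f).

(** [EndSet] speaks of K-points only. The Nullstellensatz puts a power of each X_i into the ideal of
    the forms, which settles all points of the scheme. *)
Lemma End_cover p : exists j, forms f j \notin (p : {pred _}).
Proof.
pose Q (j : 'I_n.+1) (v : form_tuple K n d) : {mpoly K[n.+1]} :=
  (v : {ffun 'I_n.+1 -> dhomog n.+1 K d}) j.
have homQ j v : Q j v \is d.-homog by apply: dhomog_is_dhomog.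
have [|N cN] := no_zero_contains homQ (v := repr_vec f).
  by move=> [z [z0 zF]]; apply: Endf; exists z.
apply: contrapT => /forallNP pF.
have [i nXi] := pt_relevant p.
have [u E] : gen_ideal Q (repr_vec f) ('X_i ^+ N).
  by apply: cN; exact: mpolyXn_homog.
have := ptXN N nXi; rewrite E => /negP; apply.
apply: (big_ind (fun G => G \in (p : {pred _}))); [exact: pt0|exact: ptD|move=> j _].
by rewrite mulrC; apply: ptM; apply/negPn/negP/pF.
Qed.

Lemma det_diff_mx_frac i j : forms f j != 0 -> \det (diff_mx f i j) =
  tofrac ((-1) ^+ (j + i) * ('X_i ^+ n.+1 * c)) / tofrac (forms f j ^+ n.+1).
Proof.
move=> Fj0; rewrite (det_diff_mx n0 Fj0 (jacc i)) mulrA; congr (_ / _).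
by rewrite [RHS]tofracM; congr (_ * _); rewrite tofracXn tofracN tofrac1.
Qed.

(** Up to powers of X_i and F_j, both outside [p], the chart determinant is c, so [I p] is c times
    the fractions of degree -D with denominator outside [p], whatever the chart. *)
Lemma critical_stalkP p g : I p g <-> exists e u v,
  [/\ u \is e.-homog, v \is (e + D)%N.-homog, v \notin (p : {pred _}) &
      g = tofrac (u * c) / tofrac v].
Proof.
have degE e : ((e + n.+1 * d) = (e + n.+1 + n.+1 * d.-1))%N.
  by rewrite -addnA -mulnS prednK.
split=> [[i [j [nXi nFj [_ [e [s [t [hs ht nt ->]]] ->]]]]]|[e [u [v [hu hv nv ->]]]]].
  exists (e + n.+1)%N, ((-1) ^+ (j + i) * s * 'X_i ^+ n.+1), (t * forms f j ^+ n.+1); split.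
  - apply: dhomogM; last exact: mpolyXn_homog.
    by rewrite -signr_odd; case: odd; rewrite ?expr0 ?expr1 ?mul1r ?mulN1r ?dhomogN.
  - rewrite -degE; apply: dhomogM => //; rewrite mulnC.
    by apply: dhomogMn; apply: forms_homog.
  - by apply: ptMN => //; apply: ptXN.
  rewrite (det_diff_mx_frac _ (pt_neq0 nFj)) frac_mul; congr (tofrac _ / _).
  by rewrite [s * _]mulrCA !mulrA.
have [i nXi] := pt_relevant p; have [j nFj] := End_cover p.
exists i, j; split=> //.
exists (tofrac ((-1) ^+ (j + i) * u * forms f j ^+ n.+1) / tofrac (v * 'X_i ^+ n.+1)).
  exists (e + n.+1 * d)%N, ((-1) ^+ (j + i) * u * forms f j ^+ n.+1), (v * 'X_i ^+ n.+1).
  split=> //.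
  - apply: dhomogM; last by rewrite mulnC; apply: dhomogMn; apply: forms_homog.
    by rewrite -signr_odd; case: odd; rewrite ?expr0 ?expr1 ?mul1r ?mulN1r ?dhomogN.
  - rewrite degE addnAC; apply: dhomogM => //.
    exact: mpolyXn_homog.
  - by apply: ptMN => //; apply: ptXN.
rewrite (det_diff_mx_frac _ (pt_neq0 nFj)) frac_mul.
have v0 := pt_neq0 nv; have X0 := pt_neq0 (ptXN n.+1 nXi); have F0 := pt_neq0 (ptXN n.+1 nFj).
have vXF0 := mulf_neq0 (mulf_neq0 v0 X0) F0.
apply/(frac_eq _ _ v0 vXF0).
set a := _ ^+ (j + i); set x := 'X_i ^+ _; set y := forms f j ^+ _.
have aa : a * a = 1 by rewrite -expr2 sqrr_sign.
transitivity (a * a * (u * c * (v * x * y))); first by rewrite aa mul1r.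
by rewrite [LHS](AC (2*(2*3)) ((1*3*7)*(2*(6*4))*5)).
Qed.

Lemma critical_stalk0 p : I p 0.
Proof.
apply/critical_stalkP; have [i nXi] := pt_relevant p.
exists 0%N, 0, ('X_i ^+ D); split; first exact: dhomog0.
- by rewrite add0n; apply: mpolyXn_homog.
- exact: ptXN.
by rewrite mul0r tofrac0 mul0r.
Qed.

Lemma critical_stalk_full p : c \notin (p : {pred _}) -> I p = local_ring p.
Proof.
move=> nc; apply/seteqP; split=> g.
  move=> /critical_stalkP[e [u [v [hu hv nv ->]]]].
  by exists (e + D)%N, (u * c), v; split=> //; apply: dhomogM.
move=> [e [a [b [ha hb nb ->]]]]; apply/critical_stalkP.
exists e, a, (b * c); split=> //; [exact: dhomogM|exact: ptMN|].
apply/frac_eq; rewrite ?mulf_neq0 ?(pt_neq0 nb) ?(pt_neq0 nc) //.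
by rewrite -mulrA [c * b]mulrC.
Qed.

Lemma critical_supportE : subscheme_support I = vanishing c.
Proof.
apply/seteqP; split=> p /= => [neq|pc eqI].
  by apply/negPn/negP => /critical_stalk_full.
have : I p 1.
  rewrite eqI; exists 0%N, 1, 1; split; rewrite ?dhomog1 ?pt1 //.
  by rewrite tofrac1 divr1.
move=> /critical_stalkP[e [u [v [_ _ nv]]]].
rewrite -[1](@divr1) -tofrac1 => /frac_eq.
rewrite oner_eq0 (pt_neq0 nv) mul1r mulr1 => /(_ isT isT) vE.
by move: nv; rewrite vE ptM.
Qed.

Lemma irreducible_critical_locus : irreducible_elt c -> integral_critical_locus f.
Proof.
move=> irrc; have c_irr := vanishing_irreducible n0 irrc homc.
split=> //; rewrite /hypersurface /integral_subscheme critical_supportE.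
  move=> Y [irrY subY maxY].
  have -> : Y = vanishing c.
    by apply/seteqP; split=> //; apply: maxY.
  have [z zP] := @zero_point_exists K n.
  have c_neq0 : c != 0 by case: irrc.
  have nT : vanishing c <> setT.
    move=> E; have cz : c \in (z : {pred _}) by change (vanishing c z); rewrite E.
    by rewrite zP (negPf c_neq0) in cz.
  split.
    exists (fun k => if k == 0%N then vanishing c else setT); split=> //.
      move=> [|[|k]] //= _; first by split=> //; apply: vanishing_closed homc.
      by split; [apply: setT_closed|apply: setT_irreducible].
    move=> [|k] //= _; rewrite properEneq; split; first exact/eqP.
    exact: subsetT.
  (* The second member of a chain is already the whole space, so there is no third. *)
  move=> [|[|m]] W // [W0 Wcl Wlt].
  have [cl1 irr1] := Wcl 1%N isT.
  have W1 : W 1%N = setT.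
    apply: (closed_above_vanishing n0 irrc homc cl1 irr1).
    by rewrite -W0; apply: Wlt.
  have := Wlt 1%N isT; rewrite W1 properEneq => -[/eqP ne sub].
  by exfalso; apply: ne; apply/seteqP; split.
(* Reducedness: if (a/b)^k lies in the stalk at a point of c = 0, then c divides a^k v with v
   outside the point, hence c divides a. *)
split=> // p g k [e [a [b [ha hb nb ->]]]] Igk.
have [pc|npc] := boolP (c \in (p : {pred _})); last first.
  by rewrite (critical_stalk_full npc); exists e, a, b.
have [->|a0] := eqVneq a 0; first by rewrite tofrac0 mul0r; apply: critical_stalk0.
move: Igk => /critical_stalkP[e' [u [v [_ _ nv]]]].
have b0 := pt_neq0 nb.
rewrite exprMn exprVn -!tofracXn => /frac_eq.
rewrite expf_neq0 // (pt_neq0 nv) => /(_ isT isT) E.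
have [cU q] : c \isn't a GRing.unit /\ divides c (a ^+ k).
  split; first by case: irrc.
  have [|//|cv] := @mpoly_irreducible_prime _ _ c (a ^+ k) v irrc.
    by exists (u * b ^+ k); rewrite E mulrCA mulrA.
  by exfalso; move/negP: nv; apply; apply: pt_divides cv pc.
have ca : divides c a.
  elim: k q {E} => [[q E]|k IHk]; last first.
    by rewrite exprS => /(mpoly_irreducible_prime irrc)[].
  by move: cU => /negP[]; apply/unitrP; exists q; rewrite mulrC -E.
case: ca => r aE; rewrite aE in a0 ha.
have [le_e hr] := homog_cofactor a0 homc ha.
apply/critical_stalkP; exists (e - D)%N, r, b; split=> //; first by rewrite subnK.
by congr (tofrac _ / _); rewrite aE mulrC.
Qed.

Lemma dvd_power_of_factors (G C : {mpoly K[n.+1]}) e : C != 0 -> C \is e.-homog ->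
  (forall w k, irreducible_elt w -> w \is k.-homog -> divides w C -> divides w G) ->
  exists k, divides C (G ^+ k).
Proof.
have [m] := ubnP e; elim: m e C => // m IHm e C /ltnSE le_m C0 hC wG.
case: e hC le_m => [hC _|e hC le_m].
  exists 0%N; have /unitrP[q [_ E]] := homog0_unit C0 hC.
  by exists q; rewrite E.
have [w [k [irrw hw [q E]]]] := irreducible_homog_factor C0 (ltn0Sn e) hC.
rewrite E in C0 hC; have [le_k hq] := homog_cofactor C0 hw hC.
have k0 := irreducible_homog_gt0 irrw hw.
move: (C0); rewrite mulf_eq0 negb_or => /andP[_ q0].
have [|w' k' irrw' hw' [r qE]|j [s sE]] := IHm _ _ _ q0 hq.
- by apply: leq_trans le_m; rewrite ltn_subrL k0.
- by apply: (wG w' k') => //; rewrite E qE; exists (w * r); rewrite mulrCA.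
have [r rE] : divides w G by apply: (wG w k) => //; rewrite E; exists q.
exists j.+1, (r * s); rewrite exprS sE rE E.
by rewrite -!mulrA; congr (_ * _); rewrite mulrCA.
Qed.

(** Every irreducible factor of c divides G, so c divides a power of G. At the generic point of a
    factor of H, reducedness would then put G itself into the stalk, and cancelling G would make a
    denominator divisible by that factor of H. *)
Lemma reducible_not_reduced k1 k2 (G H : {mpoly K[n.+1]}) : (0 < k1)%N -> (0 < k2)%N ->
  G \is k1.-homog -> H \is k2.-homog -> c = G * H -> c != 0 ->
  vanishing c `<=` vanishing G -> ~ reduced_subscheme I.
Proof.
move=> a0 b0 hG hH cE c0 sub red.
have DE : (k1 + k2 = D)%N.
  by apply: dhomog_uniq c0 _ homc; rewrite cE; apply: dhomogM.
move: (c0); rewrite cE mulf_eq0 negb_or => /andP[G0 H0].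
have [k cGk] : exists k, divides c (G ^+ k).
  apply: dvd_power_of_factors c0 homc _ => w k irrw hw wc.
  have [p pP] := irreducible_point_exists n0 irrw hw.
  by apply/pP; apply: sub; apply/pP.
have [w [e [irrw hw [H' HE]]]] := irreducible_homog_factor H0 b0 hH.
have [p pP] := irreducible_point_exists n0 irrw hw.
have [i nXi] := pt_relevant p.
have hX m : 'X_i ^+ m \is [in K[n.+1], m.-homog].
  exact: mpolyXn_homog.
have Igk : I p ((tofrac G / tofrac ('X_i ^+ k1)) ^+ k).
  case: cGk => q qE; apply/critical_stalkP.
  have hGk : G ^+ k \is (k1 * k)%N.-homog by apply: dhomogMn.
  have Gk0 : G ^+ k != 0 by rewrite expf_neq0.
  rewrite qE in hGk Gk0; have [le_D hq] := homog_cofactor Gk0 homc hGk.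
  exists (k1 * k - D)%N, q, ('X_i ^+ (k1 * k)); split=> //.
  - by rewrite subnK.
  - exact: ptXN.
  by rewrite exprMn exprVn -!tofracXn qE exprM [c * q]mulrC.
have /critical_stalkP[e' [u [v [_ _ nv]]]] : I p (tofrac G / tofrac ('X_i ^+ k1)).
  by apply: red Igk; exists k1, G, ('X_i ^+ k1); split=> //; apply: ptXN.
move=> /frac_eq; rewrite (pt_neq0 (ptXN k1 nXi)) (pt_neq0 nv) => /(_ isT isT) E.
move/negP: nv; apply; apply/pP; exists (H' * u * 'X_i ^+ k1).
apply: (mulfI G0); rewrite E cE HE.
by rewrite [LHS](AC ((1*(1*2))*1) (2*(3*(4*1*5)))).
Qed.

Lemma integral_critical_locusP : (1 < D)%N ->
  integral_critical_locus f <->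
  ~ exists k1 G H, [/\ (0 < k1 < D)%N, G != 0, G \is k1.-homog, H \is (D - k1).-homog & c = G * H].
Proof.
move=> D1; split=> [[_ hyp [irr red]] [k1 [G [H [/andP[a0 lt_a] G0 hG hH cE]]]]|nred].
  (* For c = 0 the support is the whole space; it has no chain of length 1 above it, so the
     codimension condition fails. *)
  have [c0|c0] := eqVneq c 0.
    have suppT : subscheme_support I = setT.
      rewrite critical_supportE c0; apply/seteqP; split=> // p _.
      exact: pt0.
    move: hyp; rewrite /hypersurface suppT => /(_ setT)[].
      by split=> //; apply: setT_irreducible.
    move=> [W [W0 _ Wlt]] _; have := Wlt 0%N isT; rewrite W0 properEneq => -[/eqP ne sub].
    by apply: ne; apply/seteqP; split.
  rewrite critical_supportE in irr; have [_ irr'] := irr.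
  have [|sub|sub] := irr' _ _ (vanishing_closed hG) (vanishing_closed hH).
  - by move=> p; rewrite /vanishing /= cE => /pt_prime/orP[]; [left|right].
  - by apply: (reducible_not_reduced a0 _ hG hH cE c0 sub red); rewrite subn_gt0.
  - rewrite mulrC in cE; apply: (reducible_not_reduced _ a0 hH hG cE c0 sub red).
    by rewrite subn_gt0.
have hX : 'X_ord0 \is [in K[n.+1], 1.-homog] by rewrite dhomogX /= mdeg1.
have X0 : 'X_ord0 != 0 :> {mpoly K[n.+1]} by case: (mpolyX_irreducible K (@ord0 n)).
apply: irreducible_critical_locus; split.
- apply/eqP => c0; apply: nred; exists 1%N, 'X_ord0, 0; split=> //; first exact: dhomog0.
  by rewrite mulr0.
- apply/negP => cU; have c0 : c != 0 by apply: contraTneq cU => ->; rewrite unitr0.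
  by have := dhomog_uniq c0 homc (unit_homog0 cU); move: D1; case: D.
move=> G H E; have [c0|c0] := eqVneq c 0.
  exfalso; apply: nred; exists 1%N, 'X_ord0, 0; split=> //; first exact: dhomog0.
  by rewrite mulr0.
have [k1 [k2 [DE hG hH]]] : exists i j, [/\ (i + j = D)%N, G \is i.-homog & H \is j.-homog].
  by have := homc; move: c0; rewrite E; apply: homog_factor.
have GH0 : G * H != 0 by rewrite -E.
move: GH0; rewrite mulf_eq0 negb_or => /andP[G0 H0].
have [a0|a0] := posnP k1; first by left; apply: homog0_unit => //; rewrite a0 in hG.
have [b0|b0] := posnP k2; first by right; apply: homog0_unit => //; rewrite b0 in hH.
exfalso; apply: nred; exists k1, G, H; split=> //; rewrite -DE ?addKn //.
by rewrite a0 -{1}[k1]addn0 ltn_add2l.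
Qed.

End Stalks.

(** * A tuple with irreducible critical form *)

Section UnivariateChoice.
Variable K : closedFieldType.
Implicit Types (r s w : {poly K}).

Lemma exists_nonroot (q : {poly K}) : q != 0 -> exists x, q.[x] != 0.
Proof. by move=> /closed_nonrootP[x]; exists x. Qed.

(** [k] only has to avoid the finitely many values -r(x) at the roots x of [w]. *)
Lemma exists_coprime_shift r w : w != 0 -> exists k, coprimep (r + k%:P) w.
Proof.
move=> w0; have [rs wE] := closed_field_poly_normal w.
have [k] : exists k, (\prod_(x <- rs) ('X + (r.[x])%:P)).[k] != 0.
  apply: exists_nonroot; rewrite prodf_seq_neq0; apply/allP => x _ /=.
  by rewrite -size_poly_eq0 size_XaddC.
rewrite horner_prod prodf_seq_neq0 => /allP nz; exists k.
rewrite wE coprimepZr ?lead_coef_eq0 // big_seq.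
apply: (big_ind (fun p => coprimep _ p)) => [|p q hp hq|x xs]; first exact: coprimep1.
  by rewrite coprimepMr hp.
rewrite coprimep_XsubC /root hornerD hornerC.
by have := nz x xs; rewrite !hornerE addrC.
Qed.

(* In characteristic dividing k the polynomial X^k + X is separable, otherwise X^k + c. *)
Lemma exists_base_poly (k N : nat) : (0 < k)%N -> exists r,
  [/\ size r = k.+1, coprimep r^`() r, coprimep r^`() (1 + 'X^N * r) &
      (1 + 'X^N * r).[0] != 0].
Proof.
move=> k0; have [kz|knz] := eqVneq (k%:R : K) 0.
  have k1 : (1 < k)%N.
    by move: k0 kz; case: (k) => [|[|j]] //= _ /eqP; rewrite oner_eq0.
  have r' : ('X^k + 'X : {poly K})^`() = 1.
    by rewrite derivD derivXn derivX -scaler_nat kz scale0r add0r.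
  exists ('X^k + 'X); rewrite r' !coprime1p; split=> //.
    by rewrite size_polyDl size_polyXn // size_polyX.
  rewrite !hornerE expr0n; case: k k0 {kz k1 r'} => // j _.
  by rewrite expr0n mulr0 addr0 oner_eq0.
(* c nonzero makes X^k + c coprime to its derivative; c different from -1 keeps 1 + X^N r nonzero at
   0 when N = 0. *)
have [c] : exists c : K, ('X * ('X + 1)).[c] != 0.
  apply: exists_nonroot; rewrite mulf_neq0 ?polyX_eq0 //.
  by rewrite -size_poly_eq0 size_XaddC.
rewrite !hornerE mulf_eq0 negb_or => /andP[c0 c1].
have r' : ('X^k + c%:P : {poly K})^`() = k%:R *: 'X^(k.-1).
  by rewrite derivD derivXn derivC addr0 scaler_nat.
have s0 : (1 + 'X^N * ('X^k + c%:P) : {poly K}).[0] != 0.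
  rewrite !hornerE; rewrite !expr0n (gtn_eqF k0) add0r.
  by have [N0|N0] := eqVneq N 0%N; [rewrite mul1r addrC|rewrite mul0r addr0 oner_eq0].
exists ('X^k + c%:P); rewrite r' !coprimepZl //; split=> //.
- by rewrite size_polyDl size_polyXn // size_polyC; case: (c != 0).
- rewrite coprimep_expl // coprimep_sym coprimepX /root !hornerE expr0n.
  by rewrite (gtn_eqF k0) add0r.
- by rewrite coprimep_expl // coprimep_sym coprimepX.
Qed.

Variables (k N : nat) (r : {poly K}).
Hypotheses (k0 : (0 < k)%N) (size_r : size r = k.+1) (sep_r : coprimep r^`() r)
  (cop_rs : coprimep r^`() (1 + 'X^N * r)) (s_0 : (1 + 'X^N * r).[0] != 0).
Local Notation s := (1 + 'X^N * r).

Lemma size_s : size s = (N + k).+1.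
Proof.
have r0 : r != 0 by rewrite -size_poly_eq0 size_r.
have sX : size ('X^N * r) = (N + k).+1.
  have Xn0 : 'X^N != 0 :> {poly K} by rewrite -size_poly_eq0 size_polyXn.
  by rewrite size_mul // size_polyXn size_r addnS.
by rewrite addrC size_polyDl sX // size_poly1 ltnS addn_gt0 k0 orbT.
Qed.

Lemma deriv_base_neq0 : r^`() != 0.
Proof.
apply: contraTneq sep_r => ->; rewrite coprime0p -size_poly_eq1 size_r.
by case: (k) k0.
Qed.

Lemma size_tail : size (r * s + 'X * r^`()) = (N + 2 * k).+1.
Proof.
have r0 : r != 0 by rewrite -size_poly_eq0 size_r.
have s0 : s != 0 by rewrite -size_poly_eq0 size_s.
have srs : size (r * s) = (N + 2 * k).+1.
  by rewrite size_mul // size_r size_s addSn addnS /= addnCA mul2n addnn.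
rewrite size_polyDl srs // mulrC size_mulX ?deriv_base_neq0 // ltnS.
have le_k : (size r^`() <= k)%N by rewrite -ltnS -size_r lt_size_deriv.
apply: leq_ltn_trans le_k _; rewrite mul2n -addnn addnA.
by rewrite -{1}[k]add0n ltn_add2r addn_gt0 k0 orbT.
Qed.

(** Modulo r' the tail r s + x r' is r s, modulo s it is x r'; both are units by the choice of [r].
    The shift [c] takes care of the other factor. *)
Lemma exists_coprime_pair : exists c,
  coprimep (r^`() * s) ((r + c%:P) * (r * s + 'X * r^`())) /\
  size ((r + c%:P) * (r * s + 'X * r^`())) = (N + 3 * k).+1.
Proof.
have s0 : s != 0 by rewrite -size_poly_eq0 size_s.
have [c cop] : exists c, coprimep (r + c%:P) (r^`() * s).
  by apply: exists_coprime_shift; rewrite mulf_neq0 ?deriv_base_neq0.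
have sc : size (r + c%:P) = k.+1.
  by rewrite size_polyDl // size_r size_polyC; case: (c != 0); rewrite //= ltnS.
exists c; split; last first.
  have c0 : r + c%:P != 0 by rewrite -size_poly_eq0 sc.
  have t0 : r * s + 'X * r^`() != 0 by rewrite -size_poly_eq0 size_tail.
  by rewrite size_mul // sc size_tail addSn addnS /= addnCA -mulSn.
rewrite coprimepMr coprimep_sym cop /= coprimepMl; apply/andP; split.
  by rewrite addrC coprimep_addl_mul coprimepMr sep_r.
rewrite coprimep_addl_mul coprimepMr coprimepX /root s_0 /=.
by rewrite coprimep_sym.
Qed.

End UnivariateChoice.

(** * Restriction of forms to the plane *)

Section AffinePlane.
Variables (K : fieldType) (m : nat).
Local Notation n := m.+2.
Local Notation y1 := (lift ord0 ord0 : 'I_n.+1).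
Local Notation y2 := (lift ord0 (lift ord0 ord0) : 'I_n.+1).
Implicit Types (a b r : {poly K}) (j l : 'I_n.+1).

(* Restriction to the affine plane x_0 = 1, x_3 = ... = x_n = 0, with coordinates
   x = x_1 (inner variable) and z = x_2 (outer variable). *)
Definition plane_var j : {poly {poly K}} :=
  if val j is 0 then 1 else if val j is 1 then 'X%:P else if val j is 2 then 'X else 0.

Definition plane : {mpoly K[n.+1]} -> {poly {poly K}} :=
  mmap (polyC \o @polyC K) plane_var.

HB.instance Definition _ := GRing.RMorphism.on plane.

Lemma plane_mvar j : plane 'X_j = plane_var j.
Proof. by rewrite /plane mmapX mmap1U. Qed.

Lemma planeZ c p : plane (c *: p) = c%:P%:P * plane p.
Proof. by rewrite /plane mmapZ. Qed.

Definition binary_monom (k i : nat) : 'X_{1..n.+1} := (U_(y1) *+ i + U_(ord0) *+ (k - i))%MM.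

(* The form of degree k in x_0, x_1 dehomogenizing to r. *)
Definition binary_form (k : nat) r : {mpoly K[n.+1]} :=
  \sum_(i < k.+1) r`_i *: 'X_[binary_monom k i].

Lemma binary_form_homog k r : binary_form k r \is k.-homog.
Proof.
apply: rpred_sum => i _; apply: rpredZ; rewrite dhomogX /= /binary_monom.
by rewrite mdegD !mdegMn !mdeg1 !mul1n subnKC // -ltnS.
Qed.

Lemma plane_binary_monom k i : plane 'X_[binary_monom k i] = ('X^i)%:P.
Proof.
rewrite /binary_monom mpolyXD -!mpolyXn rmorphM !rmorphXn /= !plane_mvar /=.
by rewrite /plane_var /= expr1n mulr1 -rmorphXn.
Qed.

Lemma plane_binary_form k r : (size r <= k.+1)%N -> plane (binary_form k r) = r%:P.
Proof.
move=> sr; rewrite raddf_sum /= -[in RHS](coefK r) (poly_def _ _).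
rewrite (big_ord_widen k.+1 (fun i => r`_i *: 'X^i)) // [in RHS]big_mkcond rmorph_sum /=.
apply: eq_bigr => i _; rewrite planeZ plane_binary_monom -polyCM mul_polyC.
by case: ltnP => // le_i; rewrite nth_default // scale0r.
Qed.

Lemma plane_deriv1_binary_form k r : (size r <= k.+1)%N ->
  plane (binary_form k r)^`M(y1) = (r^`())%:P.
Proof.
move=> sr; rewrite /binary_form (raddf_sum (mderiv y1)) rmorph_sum /=.
rewrite -[in RHS](coefK r) (poly_def _ _).
rewrite (big_ord_widen k.+1 (fun i => r`_i *: 'X^i)) // [in RHS]big_mkcond.
rewrite [in RHS]raddf_sum rmorph_sum /=.
apply: eq_bigr => i _; rewrite mderivZ planeZ mderivX planeZ.
have -> : binary_monom k i y1 = i.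
  by rewrite /binary_monom mnmDE !mulmnE !mnm1E /= mul1n mul0n addn0.
have -> : (if (i < size r)%N then r`_i *: 'X^i else 0) = r`_i *: 'X^i.
  by case: ltnP => // le_i; rewrite nth_default // scale0r.
rewrite derivZ derivXn.
have [i0|i0] := posnP (i : nat); first by rewrite i0 mulr0n scaler0 !(mul0r, mulr0).
have -> : (binary_monom k i - U_(y1) = U_(y1) *+ i.-1 + U_(ord0) *+ (k - i))%MM.
  apply/mnmP => j; rewrite /binary_monom mnmBE !mnmDE !mulmnE !mnm1E.
  case: (y1 == j); last by rewrite !mul0n add0n subn0.
  by rewrite !mul1n -{1}(prednK i0) addSn subn1.
rewrite mpolyXD -!mpolyXn rmorphM !rmorphXn /= !plane_mvar /= /plane_var /= expr1n mulr1.
rewrite -rmorphXn -!polyCM; congr (_%:P).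
by rewrite -scaler_nat -!mul_polyC.
Qed.

Lemma deriv_binary_form k r j : (1 < j)%N -> (binary_form k r)^`M(j) = 0.
Proof.
move=> j1; rewrite raddf_sum big1 //= => i _; rewrite mderivZ mderivX.
have ne1 : (y1 == j) = false by rewrite -val_eqE /= ltn_eqF.
have ne0 : (ord0 == j) = false by rewrite -val_eqE /= ltn_eqF // ltnW.
by rewrite /binary_monom mnmDE !mulmnE !mnm1E ne1 ne0 !mul0n scale0r scaler0.
Qed.

Lemma mderiv_var l j : ('X_l : {mpoly K[n.+1]})^`M(j) = (l == j)%:R.
Proof.
rewrite mderivX mnm1E; case: eqP => [->|_]; last by rewrite scale0r.
by rewrite scale1r -[X in (X - _)%MM]addm0 addmC addmK mpolyX0.
Qed.

(** Each variable becomes a polynomial of degree at most 1 in x at z = 0. This bounds the part free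
    of z that a factor of degree k can carry. *)
Lemma size_plane_horner0 k (p : {mpoly K[n.+1]}) : p \is k.-homog ->
  (size (plane p).[0%:P] <= k.+1)%N.
Proof.
move=> hp; rewrite [p]mpolyE raddf_sum /= horner_sum big_seq.
apply: (big_ind (fun q : {poly K} => (size q <= k.+1)%N)) => [|p1 p2 s1 s2|x /(dhomog_mf hp) /= dx].
- by rewrite size_poly0.
- by rewrite (leq_trans (size_polyD _ _)) // geq_max s1.
rewrite planeZ hornerCM mul_polyC (leq_trans (size_scale_leq _ _)) //.
rewrite mpolyXE_id rmorph_prod /= horner_prod.
have sv j : (size (plane_var j).[0%:P] <= 2)%N.
  case: j => [[|[|[|j]]] lt_j]; rewrite /plane_var /= !hornerE;
  by rewrite ?size_poly1 ?size_polyX ?size_poly0.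
apply: leq_trans (size_prod_leq _ _) _; rewrite cardT size_enum_ord leq_subLR.
rewrite addnS ltnS -dx mdegE -[X in (_ <= X + _)%N]card_ord -sum1_card -big_split /=.
apply: leq_sum => j _; rewrite rmorphXn /= horner_exp.
apply: leq_trans (size_poly_exp_leq _ _) _.
rewrite plane_mvar; have s1 : ((size (plane_var j).[0%:P]).-1 <= 1)%N.
  by have := sv j; case: (size _) => [|[|[]]].
by case: (_.-1) s1 => [|[|]] //= _; rewrite ?mul0n ?mul1n // add1n.
Qed.

Section LinearFamily.
Variables (e : nat) (a : 'I_n.+1 -> {poly K}) (b : 'I_n.+1 -> 'I_n.+1 -> {poly K}).
Hypotheses (size_a : forall l, (size (a l) <= e.+2)%N)
  (size_b : forall l j, (size (b l j) <= e.+1)%N).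

(** These forms are at most linear in x_2, ..., x_n, so on the plane their values and derivatives
    are read off from [a] and [b]. *)
Definition family l : {mpoly K[n.+1]} :=
  binary_form e.+1 (a l) + \sum_(j : 'I_n.+1 | (1 < j)%N) binary_form e (b l j) * 'X_j.

Lemma family_homog l : family l \is e.+1.-homog.
Proof.
apply: rpredD; first exact: binary_form_homog.
apply: rpred_sum => j _; rewrite -[e.+1]addn1.
by apply: dhomogM (binary_form_homog _ _) (mpolyX_homog _ _).
Qed.

Let sum_plane (F : 'I_n.+1 -> {poly {poly K}}) :
  \sum_(j : 'I_n.+1 | (1 < j)%N) F j * plane_var j = F y2 * 'X.
Proof.
rewrite (bigD1 y2) //= {1}/plane_var /= big1 ?addr0 // => j /andP[j1 ne_j].
rewrite /plane_var; case: j j1 ne_j => [[|[|[|j]]] lt_j] //=; rewrite ?mulr0 //.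
Qed.

Lemma plane_family l : plane (family l) = (a l)%:P + (b l y2)%:P * 'X.
Proof.
rewrite /family rmorphD /= plane_binary_form //; congr (_ + _).
rewrite rmorph_sum /= -(sum_plane (fun j => (b l j)%:P)); apply: eq_bigr => j _.
by rewrite rmorphM /= plane_binary_form // plane_mvar.
Qed.

Lemma plane_family_deriv1 l :
  plane (family l)^`M(y1) = ((a l)^`())%:P + ((b l y2)^`())%:P * 'X.
Proof.
rewrite /family mderivD rmorphD /= plane_deriv1_binary_form //; congr (_ + _).
rewrite (raddf_sum (mderiv y1)) rmorph_sum /= -(sum_plane (fun j => ((b l j)^`())%:P)).
apply: eq_bigr => j j1; rewrite mderivM rmorphD /= !rmorphM /=.
rewrite plane_deriv1_binary_form // plane_mvar mderiv_var.
by rewrite -val_eqE /= gtn_eqF // rmorph0 mulr0 addr0.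
Qed.

Lemma plane_family_deriv l j : (1 < j)%N -> plane (family l)^`M(j) = (b l j)%:P.
Proof.
move=> j1; rewrite /family mderivD deriv_binary_form // add0r.
rewrite (raddf_sum (mderiv j)) (bigD1 j) //= big1.
  rewrite addr0 mderivM deriv_binary_form // mul0r add0r mderiv_var eqxx mulr1.
  exact: plane_binary_form.
move=> i /andP[i1 ne_ij]; rewrite mderivM deriv_binary_form // mul0r add0r.
by rewrite mderiv_var (negPf ne_ij) mulr0.
Qed.

End LinearFamily.
End AffinePlane.

Section Det3.
Variable R : comNzRingType.

Lemma det3 (A : 'M[R]_3) : A (lift ord0 (lift ord0 ord0)) (lift ord0 (lift ord0 ord0)) = 0 ->
  \det A =
  A ord0 (lift ord0 (lift ord0 ord0)) *
    (A (lift ord0 ord0) ord0 * A (lift ord0 (lift ord0 ord0)) (lift ord0 ord0)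
     - A (lift ord0 ord0) (lift ord0 ord0) * A (lift ord0 (lift ord0 ord0)) ord0)
  - A (lift ord0 ord0) (lift ord0 (lift ord0 ord0)) *
    (A ord0 ord0 * A (lift ord0 (lift ord0 ord0)) (lift ord0 ord0)
     - A ord0 (lift ord0 ord0) * A (lift ord0 (lift ord0 ord0)) ord0).
Proof.
move=> A0; rewrite (expand_det_col A (lift ord0 (lift ord0 ord0))) !big_ord_recl big_ord0.
rewrite A0 mul0r !addr0 /cofactor !(expand_det_row _ ord0) !big_ord_recl !big_ord0.
rewrite /cofactor !(expand_det_row _ ord0) !big_ord_recl !big_ord0 /cofactor !det_mx00 !mxE.
pose f i j := A (inord i) (inord j).
have fE i j : A i j = f i j by rewrite /f !inord_val.
rewrite !fE /= /bump /= !(addn0, add0n) !addn1 /= !expr0 !mulr1 !mul1r !addr0 !expr1.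
rewrite (_ : (-1) ^+ 2 = 1) ?mul1r; last by rewrite expr2 mulrNN mulr1.
rewrite (_ : (-1) ^+ (1 + 2) = -1) ?mulN1r ?mulrN //.
by rewrite addn2 !exprS expr0 mulr1 !mulN1r opprK.
Qed.

End Det3.

Section Example.
Variables (K : fieldType) (m e : nat) (r : {poly K}) (c : K).
Local Notation n := m.+2.
Local Notation y1 := (lift ord0 ord0).
Local Notation y2 := (lift ord0 (lift ord0 ord0)).
Local Notation s := (1 + 'X^(e * m) * r).
Local Notation mu := (r + c%:P).

(* In affine coordinates x_0 = 1, x = x_1, z = x_2, F_0 = mu z, F_1 = z + x r, and rows
   2, ..., n of the Jacobian matrix form a chain: F_2 = 1 - x^e x_3,
   F_l = x_l - x^e x_(l+1) for 2 < l < n, and r is added to F_n. Hence on the plane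
   the determinant is that of a 3 x 3 matrix with last row
   sum_(2 <= l <= n) x^(e (l - 2)) (row l). *)
Definition ex_a (l : 'I_n.+1) : {poly K} :=
  match val l with
  | 0 => 0
  | 1 => 'X * r
  | l'.+2 => (if l' == 0%N then 1 else 0) + (if l' == m then r else 0)
  end.

Definition ex_b (l j : 'I_n.+1) : {poly K} :=
  match val l with
  | 0 => if val j == 2 then mu else 0
  | 1 => if val j == 2 then 1 else 0
  | l'.+2 => if val j == 2 then 0 else
      (if val j == l'.+2 then 1 else 0) - (if val j == l'.+3 then 'X^e else 0)
  end.

Definition ex_form := family e ex_a ex_b.

Hypothesis e0 : (0 < e)%N.
Hypothesis size_r : size r = e.+1.

Lemma ex_mu_size : (size mu <= e.+1)%N.
Proof.
rewrite (leq_trans (size_polyD _ _)) // size_r geq_max leqnn /= size_polyC.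
by case: (c != 0).
Qed.

Lemma ex_a_size l : (size (ex_a l) <= e.+2)%N.
Proof.
rewrite /ex_a; case: (val l) => [|[|k]]; first by rewrite size_poly0.
  by rewrite mulrC (leq_trans (size_polyMleq _ _)) // size_polyX size_r addn2.
rewrite (leq_trans (size_polyD _ _)) // geq_max.
case: ifP => _; case: ifP => _; rewrite ?size_poly1 ?size_poly0 ?size_r ?leqnSn //=.
Qed.

Lemma ex_b_size l j : (size (ex_b l j) <= e.+1)%N.
Proof.
rewrite /ex_b; case: (val l) => [|[|k]]; case: ifP => _;
  rewrite ?size_poly0 ?size_poly1 ?ex_mu_size //.
rewrite (leq_trans (size_polyD _ _)) // geq_max size_polyN.
by do 2 case: ifP => _; rewrite ?size_poly0 ?size_poly1 ?size_polyXn ?leqnn.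
Qed.

Definition ex_mx : 'M[{poly {poly K}}]_n.+1 := \matrix_(l, k)
  match val k with
  | 0 => (ex_a l)%:P + (ex_b l y2)%:P * 'X
  | 1 => ((ex_a l)^`())%:P + ((ex_b l y2)^`())%:P * 'X
  | _ => (ex_b l k)%:P
  end.

Lemma plane_jac_ex : map_mx (@plane K m) (jac_mx ex_form ord0) = ex_mx.
Proof.
apply/matrixP => l k; rewrite !mxE -val_eqE /=.
case: k => [[|[|k]] lt_k] /=.
- exact: (plane_family ex_a_size ex_b_size).
- rewrite (_ : Ordinal lt_k = y1); last exact: val_inj.
  exact: (plane_family_deriv1 ex_a_size ex_b_size).
- exact: (plane_family_deriv _ ex_b_size).
Qed.

Let M : 'M[{poly {poly K}}]_(3 + m) := ex_mx.

(** Adds to row 2 the later rows 3 + j, multiplied by x^(e (j + 1)). Along the chain these multiples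
    telescope and clear the columns from 3 on. *)
Let W : 'M[{poly {poly K}}]_(3, m) :=
  \matrix_(i, j) (if val i == 2 then ('X^(e * j.+1))%:P else 0).

Let reduced_row (F : 'I_m -> {poly K}) (p : {poly K}) :
  (forall i, F i = if i.+1 == m then p else 0) ->
  \sum_(i < m) ('X^(e * i.+1))%:P * (F i)%:P =
  (if m == 0%N then 0 else 'X^(e * m) * p)%:P.
Proof.
move=> FE; under eq_bigr do rewrite -polyCM FE.
rewrite -rmorph_sum; congr (_%:P); case: (m) F FE => [|k] F FE; first by rewrite big_ord0.
rewrite big_ord_recr /= eqxx big1 ?add0r // => i _.
by rewrite eqSS ltn_eqF ?mulr0.
Qed.

Let ur_zero : ursubmx M + W *m drsubmx M = 0.
Proof.
apply/matrixP => i j; rewrite !mxE.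
have drE k : drsubmx M k j = (if val j == k then 1 else 0)
    - (if val j == k.+1 then ('X^e)%:P else 0).
  rewrite !mxE /=; rewrite /ex_b /= !eqSS rmorphB /=.
  by congr (_ - _); case: ifP.
under eq_bigr do rewrite drE mxE.
case: i => [[|[|[|i]]] lt_i] //=.
- by rewrite /ex_b /= add0r big1 // => k _; rewrite mul0r.
- by rewrite /ex_b /= add0r big1 // => k _; rewrite mul0r.
rewrite /ex_b /= !eqSS.
under eq_bigr do rewrite mulrBr.
rewrite sumrB (bigD1 j) //= eqxx mulr1 big1 ?addr0 => [|k ne_kj]; last first.
  by rewrite -val_eqE eq_sym in ne_kj; rewrite (negPf ne_kj) mulr0.
case: j {drE} => [[|j] lt_j] /=.
  rewrite big1 => [|k _]; last by rewrite mulr0.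
  by rewrite subr0 sub0r muln1 rmorphN addNr.
rewrite subr0 rmorph0 add0r (bigD1 (Ordinal (ltnW lt_j))) //= eqxx big1 ?addr0 => [|k ne_kj].
  by rewrite -rmorphM -exprD -mulnSr subrr.
by rewrite -val_eqE eq_sym /= in ne_kj; rewrite eqSS (negPf ne_kj) mulr0.
Qed.

Let dr_det : \det (drsubmx M) = 1.
Proof.
rewrite -det_tr det_trig => [|]; last first.
  apply/is_trig_mxP => i j lt_ij; rewrite !mxE /= /ex_b /= !eqSS.
  by rewrite (ltn_eqF lt_ij) (ltn_eqF (ltnW _)) ?subrr.
rewrite big1 // => i _; rewrite !mxE /= /ex_b /= !eqSS eqxx.
by rewrite ltn_eqF ?subr0.
Qed.

(** The 3 x 3 determinant, with u, u' for [mu] and its derivative, p, p' for r and its derivative,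
    and y for x^(e m). *)
Let cofactor_identity (R : comNzRingType) (z x u u' p p' y : R) :
  u * ((z + x * p) * (y * p') - (p + x * p') * (1 + y * p)) -
    (u * z * (y * p') - u' * z * (1 + y * p)) =
  u' * (1 + y * p) * z - u * (p * (1 + y * p) + x * p').
Proof.
have k : x * p * (y * p') - (p + x * p') * (1 + y * p) = - (p * (1 + y * p) + x * p').
  rewrite mulrDl [x * p' * _]mulrDr mulr1 addrA.
  have -> : x * p' * (y * p) = x * p * (y * p') by rewrite mulrACA [p' * p]mulrC mulrACA.
  by rewrite [- (_ + _ + x * p * (y * p'))]opprD addrCA subrr addr0.
rewrite mulrDl -addrA k mulrDr mulrN mulrA opprB addrC addrA subrK.
by rewrite [u' * z * _]mulrAC.
Qed.

Lemma det_ex_mx : \det ex_mx = (r^`() * s)%:P * 'X - (mu * (r * s + 'X * r^`()))%:P.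
Proof.
have -> : \det ex_mx = \det (ulsubmx M + W *m dlsubmx M).
  transitivity (\det (block_mx 1%:M W 0 1%:M *m M)).
    by rewrite det_mulmx det_ublock !det1 !mul1r.
  rewrite -[M in _ *m M]submxK mulmx_block !mul1mx !mul0mx !add0r ur_zero det_lblock.
  by rewrite dr_det mulr1.
have dl0 k : (W *m dlsubmx M) ord0 k = 0.
  by rewrite mxE big1 // => i _; rewrite mxE mul0r.
have dl1 k : (W *m dlsubmx M) y1 k = 0.
  by rewrite mxE big1 // => i _; rewrite mxE mul0r.
have dl20 : (W *m dlsubmx M) y2 ord0 = (if m == 0%N then 0 else 'X^(e * m) * r)%:P.
  rewrite mxE -(reduced_row (F := fun i => if i.+1 == m then r else 0)) //.
  apply: eq_bigr => i _; rewrite !mxE /= /ex_a /ex_b /=.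
  by rewrite rmorph0 mul0r addr0 add0r.
have dl21 : (W *m dlsubmx M) y2 y1 = (if m == 0%N then 0 else 'X^(e * m) * r^`())%:P.
  rewrite mxE -(reduced_row (F := fun i => if i.+1 == m then r^`() else 0)) //.
  apply: eq_bigr => i _; rewrite !mxE /= /ex_a /ex_b /=.
  by rewrite deriv0 rmorph0 mul0r addr0 add0r; case: ifP; rewrite ?deriv0.
have dl22 : (W *m dlsubmx M) y2 y2 = 0.
  by rewrite mxE big1 // => i _; rewrite !mxE /= /ex_b /= mulr0.
have entry i k : ulsubmx M i k = ex_mx (lshift m i) (lshift m k) by rewrite !mxE.
rewrite det3 ![(ulsubmx M + _) _ _]mxE !entry ?dl0 ?dl1 ?dl20 ?dl21 ?dl22 !mxE /= /ex_a /ex_b /=.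
  (* For m = 0 the chain is empty and F_2 carries both 1 and r; otherwise r arrives from the last
     row with the factor x^(e m). Both cases give s. *)
  have row0 : (1 + (if (0 + 0)%N == m then r else 0) : {poly K}) +
      (if m == 0%N then 0 else 'X^(e * m) * r) = s.
    by rewrite addn0 eq_sym; case: eqP => [->|_]; rewrite ?muln0 ?expr0 ?mul1r ?addr0.
  have d1 : (1 : {poly K})^`() = 0 by apply: derivC.
  have row1 : (1 + (if (0 + 0)%N == m then r else 0) : {poly K})^`() +
      (if m == 0%N then 0 else 'X^(e * m) * r^`()) = 'X^(e * m) * r^`().
    rewrite derivD d1 add0r addn0 eq_sym.
    by case: eqP => [->|_]; rewrite ?muln0 ?expr0 ?mul1r ?addr0 ?derivC ?add0r.
  rewrite deriv0 d1 !polyC0 !mul0r !addr0 !add0r -!polyCD row0 row1.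
  rewrite derivM derivX mul1r derivD derivC addr0 polyC1 !mul1r.
  rewrite !(polyCM, polyCD) polyC1 -cofactor_identity.
  by rewrite ['X%:P * _ + 'X]addrC.
by rewrite polyC0 addr0.
Qed.

End Example.

(** A factor free of the outer variable divides both coprime coefficients, so it is a nonzero
    constant, and the cofactor at 0 is E up to a scalar. *)
Lemma linear_poly_factor (K : fieldType) (A E : {poly K}) (G H : {poly {poly K}}) :
  coprimep A E -> A != 0 -> G * H = A%:P * 'X - E%:P -> (size G <= 1)%N ->
  size E = size H.[0].
Proof.
move=> cop A0 GH /size1_polyC GE; set a := G`_0 in GE.
have GH0 : a * H`_0 = - E by rewrite -coefCM -GE GH coefB coefMX !coefC /= sub0r.
have GH1 : a * H`_1 = A by rewrite -coefCM -GE GH coefB coefMX !coefC /= subr0.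
have : a %= 1.
  have /coprimepP := cop; apply; first by rewrite -GH1 dvdp_mulIl.
  by rewrite -dvdpNr -GH0 dvdp_mulIl.
rewrite -size_poly_eq1 => sa; have a0 : a != 0 by rewrite -size_poly_eq0 (eqP sa).
rewrite horner_coef0 -size_polyN -GH0; have [->|H0] := eqVneq H`_0 0; first by rewrite mulr0.
by rewrite size_mul // (eqP sa).
Qed.

Section ExampleIrreducible.
Variables (K : closedFieldType) (m e : nat).
Hypothesis e0 : (0 < e)%N.

(** On the plane the product g h is linear in z, so one of the two is free of z, hence constant
    there. The other, of degree less than D, would then carry [E], whose degree is D. *)
Lemma ex_form_exists : exists F : 'I_m.+3 -> {mpoly K[m.+3]},
  (forall l, F l \is e.+1.-homog) /\
  forall k1 k2 (g h : {mpoly K[m.+3]}), (0 < k1)%N -> (0 < k2)%N ->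
    (k1 + k2 = m.+3 * e)%N -> g \is k1.-homog -> h \is k2.-homog ->
    \det (jac_mx F ord0) <> 'X_ord0 * (g * h).
Proof.
have [r [size_r sep_r cop_r s0]] := exists_base_poly K (e * m) e0.
have [c [cop size_e]] := exists_coprime_pair e0 size_r sep_r cop_r s0.
exists (@ex_form K m e r c); split=> [l|k1 k2 g h k1_gt0 k2_gt0 k12 hg hh det_eq].
  exact: family_homog.
set s := 1 + _ in cop size_e s0 cop_r; set E := (r + c%:P) * _ in cop size_e.
have A0 : r^`() * s != 0.
  rewrite mulf_neq0 ?(deriv_base_neq0 e0 size_r sep_r) //.
  by rewrite -size_poly_eq0 (size_s _ e0 size_r).
have GH : plane g * plane h = (r^`() * s)%:P * 'X - E%:P.
  rewrite -(det_ex_mx m e r c) -(plane_jac_ex m c size_r) det_map_mx det_eq !rmorphM /=.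
  by rewrite plane_mvar mul1r.
have sE : size E = (m.+3 * e).+1 by rewrite size_e [(e * m)%N]mulnC -mulnDl addn3.
have no k j (G H : {mpoly K[m.+3]}) : (0 < k)%N -> (k + j = m.+3 * e)%N ->
    H \is j.-homog -> plane G * plane H = (r^`() * s)%:P * 'X - E%:P ->
    ~ (size (plane G) <= 1)%N.
  move=> k0 kj hH GHE sG; have := size_plane_horner0 hH.
  rewrite -(linear_poly_factor cop A0 GHE sG) sE ltnS -kj -{2}[j]add0n leq_add2r.
  by rewrite leqNgt k0.
have sGH : size (plane g * plane h) = 2.
  rewrite GH size_polyDl size_mulX ?polyC_eq0 // size_polyC A0 // size_polyN size_polyC.
  by case: (E != 0).
have /andP[G0 H0] : (plane g != 0) && (plane h != 0).
  by rewrite -negb_or -mulf_eq0 -size_poly_eq0 sGH.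
have [|sG] := leqP (size (plane g)) 1; first exact: (no k1 k2 g h k1_gt0 k12 hh GH).
have [|sH] := leqP (size (plane h)) 1.
  by apply: (no k2 k1 h g k2_gt0 _ hg); [rewrite addnC|rewrite mulrC].
have aux x y : (1 < x)%N -> (1 < y)%N -> 2 <> (x + y).-1.
  by case: x => [|[|x]] //; case: y => [|[|y]] // _ _; rewrite !addSn !addnS.
by apply: (aux _ _ sG sH); rewrite -sGH; exact: (size_mul G0 H0).
Qed.

End ExampleIrreducible.

(** * Openness and non-emptiness *)

Section Density.
Variables (K : closedFieldType) (V : vectType K).
Implicit Types (u v : V).

Lemma polyfun_homog e (f : V -> K) : polyfun e f ->
  forall t v, f (t *: v) = t ^+ e * f v.
Proof.
move=> [P hP fE] t v; rewrite !fE !mevalE mulr_sumr big_seq [RHS]big_seq.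
apply: eq_bigr => m /(dhomog_mf hP) /= <-; rewrite mulrCA; congr (_ * _).
rewrite mdegE expr_sum -big_split; apply: eq_bigr => i _ /=.
by rewrite /coords linearZ /= exprMn.
Qed.

Lemma polyfun_line e (f : V -> K) u v : polyfun e f ->
  exists p : {poly K}, forall t, f (u + t *: v) = p.[t].
Proof.
move=> [P hP fE].
exists (mmap (@polyC K) (fun i => (coords u i)%:P + coords v i *: 'X) P) => t.
rewrite fE mevalE /mmap horner_sum; apply: eq_bigr => m _.
rewrite hornerCM /mmap1 horner_prod; congr (_ * _); apply: eq_bigr => i _.
by rewrite horner_exp !hornerE /= /coords linearD linearZ /= [_ * t]mulrC.
Qed.

(** Both functions restrict to nonzero polynomials on the line of the v1 + t v2, and an infinite
    field has a common nonroot. *)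
Lemma polyfun_common_nonzero e1 e2 (f1 f2 : V -> K) v1 v2 :
  polyfun e1 f1 -> polyfun e2 f2 -> f1 v1 != 0 -> f2 v2 != 0 ->
  exists v, f1 v != 0 /\ f2 v != 0.
Proof.
move=> h1 h2 f10 f20.
have [p1 p1E] := polyfun_line v1 v2 h1; have [p2 p2E] := polyfun_line v1 v2 h2.
have p10 : p1 != 0.
  by apply: contraNneq f10 => p0; rewrite -[v1]addr0 -(scale0r v2) p1E p0 horner0.
have p20 : p2 != 0.
  (* [v2] is the point at infinity of that line, so the line is run through from [v2] and compared
     with the original by homogeneity. *)
  apply/eqP => p0; have [q qE] := polyfun_line v2 v1 h2.
  have q0 : q != 0.
    by apply: contraNneq f20 => q0; rewrite -[v2]addr0 -(scale0r v1) qE q0 horner0.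
  have [t] : exists t, ('X * q).[t] != 0 by apply: exists_nonroot; rewrite mulf_neq0 ?polyX_eq0.
  rewrite hornerM hornerX mulf_eq0 negb_or => /andP[t0]; rewrite -qE.
  have -> : v2 + t *: v1 = t *: (v1 + t^-1 *: v2).
    by rewrite scalerDr scalerA divff // scale1r addrC.
  by rewrite (polyfun_homog h2) p2E p0 horner0 mulr0 eqxx.
have [t] : exists t, (p1 * p2).[t] != 0 by apply: exists_nonroot; rewrite mulf_neq0.
by rewrite hornerM mulf_eq0 negb_or -p1E -p2E => /andP[]; exists (v1 + t *: v2).
Qed.

Lemma repr_vec_line v : v != 0 ->
  exists (x : projective V) t, t != 0 /\ repr_vec x = t *: v.
Proof.
move=> v0; have dv : \dim <[v]> == 1%N by rewrite dim_vline v0.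
exists (exist _ <[v]>%VS dv); rewrite /repr_vec /=.
have /vlineP[t tE] := memv_pick <[v]>%VS; exists t; split=> //.
apply: contra v0 => /eqP t0; move: tE; rewrite t0 scale0r => /eqP.
by rewrite vpick0 -dimv_eq0 (eqP dv).
Qed.

End Density.

Section Locus.
Variables (K : closedFieldType) (n d : nat).
Hypotheses (hn : (2 <= n)%N) (hd : (2 <= d)%N).
Local Notation V := (form_tuple K n d).
Local Notation D := (n.+1 * d.-1)%N.

Definition tuple_form (l : 'I_n.+1) (v : V) : {mpoly K[n.+1]} :=
  (v : {ffun 'I_n.+1 -> dhomog n.+1 K d}) l.

Let tuple_form_homog l v : tuple_form l v \is d.-homog.
Proof. exact: dhomog_is_dhomog. Qed.

Let tuple_formD l u v : tuple_form l (u + v) = tuple_form l u + tuple_form l v.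
Proof. by rewrite /tuple_form ffunE. Qed.

Let tuple_formZ l c v : tuple_form l (c *: v) = c%:MP * tuple_form l v.
Proof. by rewrite /tuple_form ffunE mul_mpolyC. Qed.

Lemma tuple_form_polymap l : polymap (@mpolyC n.+1 K) 1 (tuple_form l).
Proof. by apply: polymap_linear => [u v|c v]; rewrite ?tuple_formD ?tuple_formZ. Qed.

(** This is x_0 c, which, as a determinant, has coefficients polynomial in those of the tuple. *)
Definition jac_det (v : V) : {mpoly K[n.+1]} := \det (jac_mx (tuple_form^~ v) ord0).

Lemma jac_det_polymap : polymap (@mpolyC n.+1 K) (n.+1 * 1) jac_det.
Proof.
apply: polymap_det => l k.
apply: (@polymap_ext _ _ _ _ _
  (fun v => if k == ord0 then tuple_form l v else (tuple_form l v)^`M(k))).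
  by move=> v; rewrite mxE.
case: (k == ord0); first exact: tuple_form_polymap.
apply: polymap_linear => [u v|c v]; first by rewrite tuple_formD mderivD.
by rewrite tuple_formZ mderiv_mulC.
Qed.

(** i + 1 runs over the possible degrees 1, ..., D - 1 of a proper factor of c. *)
Definition reducible_tuple (v : V) : Prop :=
  exists i, (i < D.-1)%N /\ factors i.+1 (D - i.+1) 'X_ord0 jac_det v.

Let D_gt1 : (1 < D)%N.
Proof.
case: (n) hn => // n'; case: (d) hd => [|[|d']] //= _ _.
by rewrite mulSn addSn ltnS addn_gt0 orbC.
Qed.

Lemma reducible_tuple_separated : separated reducible_tuple.
Proof.
apply: separated_union => i lt_i.
have lt_iD : (i.+1 < D)%N by rewrite -[D](prednK (ltnW D_gt1)) ltnS.
apply: (factors_separated (E := (n.+1 * 1)%N) (k3 := 1%N)).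
- by case: (mpolyX_irreducible K (@ord0 n)).
- exact: mpolyX_homog.
- move=> v; rewrite subnKC ?(ltnW lt_iD) //.
  rewrite (_ : (1 + D = d + n * d.-1)%N); first exact: det_jac_mx_homog.
  by rewrite mulSn addnA add1n prednK // ltnW.
exact: jac_det_polymap.
Qed.

Lemma not_End_separated : separated (has_zero tuple_form).
Proof. exact: elimination tuple_form_homog tuple_form_polymap. Qed.

Lemma EndSetE (f : EndBar K n d) : EndSet f <-> ~ has_zero tuple_form (repr_vec f).
Proof.
split=> [Ef [z [z0 zF]]|nz [z z0 zF]]; first by apply: Ef; exists z.
by apply: nz; exists z.
Qed.

Lemma integral_critical_locusE (f : EndBar K n d) : EndSet f ->
  integral_critical_locus f <-> ~ reducible_tuple (repr_vec f).
Proof.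
move=> Ef; have n0 : (0 < n)%N by apply: ltnW.
have d0 : (0 < d)%N by apply: ltnW.
have [c homc jacc] := critical_form_exists (@forms_homog K n d f) n0 d0.
have X0 : 'X_ord0 != 0 :> {mpoly K[n.+1]} by case: (mpolyX_irreducible K (@ord0 n)).
have jE : jac_det (repr_vec f) = 'X_ord0 * c by apply: jacc.
apply: iff_trans (integral_critical_locusP n0 d0 Ef homc jacc D_gt1) _.
split=> nred.
  move=> [i [lt_i [G [H [G0 hG hH E]]]]]; apply: nred; exists i.+1, G, H; split=> //.
    by rewrite /= -[D](prednK (ltnW D_gt1)) ltnS.
  by apply: (mulfI X0); rewrite -jE E.
move=> [[|i] [G [H [/andP[i0 lt_i] G0 hG hH E]]]] //; apply: nred; exists i; split.
  by rewrite -ltnS (prednK (ltnW D_gt1)).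
by exists G, H; split=> //; rewrite jE E.
Qed.

Lemma irreducible_tuple_exists : exists v : V, ~ reducible_tuple v.
Proof.
have d0 : (0 < d.-1)%N by case: (d) hd => [|[]].
have [F [homF nF]] : exists F : 'I_n.+1 -> {mpoly K[n.+1]},
  (forall l, F l \is d.-homog) /\
  forall k1 k2 (g h : {mpoly K[n.+1]}), (0 < k1)%N -> (0 < k2)%N ->
    (k1 + k2 = D)%N -> g \is k1.-homog -> h \is k2.-homog ->
    \det (jac_mx F ord0) <> 'X_ord0 * (g * h).
  case: (n) hn => [|[|m]] // _; have := ex_form_exists K m d0.
  by rewrite (prednK (ltnW hd)).
exists [ffun l => DHomog (homF l)]; move=> [i [lt_i [G [H [_ hG hH E]]]]].
have lt_iD : (i.+1 < D)%N by rewrite -[D](prednK (ltnW D_gt1)) ltnS.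
have Di : (0 < D - i.+1)%N by rewrite subn_gt0.
apply: (nF i.+1 (D - i.+1)%N G H isT Di (subnKC (ltnW lt_iD)) hG hH).
rewrite -E; congr (\det _); apply/matrixP => l k; rewrite !mxE /tuple_form ffunE.
by [].
Qed.

Lemma End_tuple_exists : exists v : V, ~ has_zero tuple_form v.
Proof.
exists [ffun l => DHomog (mpolyXn_homog K l d)] => -[z [[i zi] /(_ i)]].
rewrite /tuple_form ffunE /= rmorphXn /= mevalXU => /eqP.
by rewrite expf_eq0 (negPf zi) andbF.
Qed.

End Locus.

Theorem theorem1p1 (K : closedFieldType) (n d : nat)
    (hn : (2 <= n)%N) (hd : (2 <= d)%N) :
  (exists f, @integral_critical_locus K n d f) /\
  open_in (@proj_closed K (form_tuple K n d)) (@EndSet K n d)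
    (@integral_critical_locus K n d).
Proof.
have sep1 := @reducible_tuple_separated K n d hn hd; have sep2 := @not_End_separated K n d.
split; last first.
  exists [set x : projective (form_tuple K n d) | reducible_tuple (repr_vec x)].
    exact: separated_closed.
  apply/seteqP; split=> f.
    by move=> lf; have [Ef _ _] := lf; split=> //; apply/(integral_critical_locusE hn hd Ef).
  by move=> [Ef nred]; apply/(integral_critical_locusE hn hd Ef).
have [v1 nv1] := @irreducible_tuple_exists K n d hn hd; have [v2 nv2] := @End_tuple_exists K n d.
have [e1 [f1 [h1 f10 f1S]]] := sep1 v1 nv1; have [e2 [f2 [h2 f20 f2S]]] := sep2 v2 nv2.
have [v [f1v f2v]] := polyfun_common_nonzero h1 h2 f10 f20.
(* All forms of the zero tuple vanish everywhere, so [f2] is 0 at the zero tuple. *)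
have v0 : v != 0.
  apply: contraNneq f2v => ->; apply/eqP/f2S; exists (fun=> 1).
  by split=> [|l]; [exists ord0; apply: oner_neq0|rewrite /tuple_form ffunE meval0].
have [x [t [t0 xE]]] := repr_vec_line v0.
have Ex : EndSet x.
  apply/EndSetE => /f2S /eqP; rewrite xE (polyfun_homog h2) mulf_eq0 expf_eq0.
  by rewrite (negPf t0) andbF (negPf f2v).
exists x; apply/(integral_critical_locusE hn hd Ex) => /f1S /eqP.
rewrite xE (polyfun_homog h1) mulf_eq0 expf_eq0.
by rewrite (negPf t0) andbF (negPf f1v).
Qed.
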